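(* Let $X$ be a normal pseudomanifold of dimension $d\geq 4$. Then $X$ is a stacked $d$-sphere if and only if $X\in \mathcal{K}(d)$ and the geometric realization $|X|$ is simply connected.
   Context: A simplicial complex is a finite set of finite sets closed under taking subsets; an element of size $i+1$ is an $i$-face (the empty set is the unique $(-1)$-face). A pure $d$-dimensional complex has all maximal faces (facets) of dimension $d$. The link of a face $\alpha$ is $\mathrm{lk}_X(\alpha)=\{\beta\in X:\beta\cap\alpha=\emptyset,\ \alpha\cup\beta\in X\}$. A $d$-dimensional normal pseudomanifold ($d\ge1$) is a pure $d$-dimensional simplicial complex in which every $(d-1)$-face lies in exactly two facets and the link of every face of dimension $\le d-2$ (including the empty face, whose link is $X$) is connected. The standard $d$-sphere $S^d_{d+2}$ is the complex of all proper subsets of a $(d+2)$-set. Starring a new vertex $v$ in a facet $\sigma$ of a pure $d$-dimensional complex replaces $\sigma$ by the facets $\tau\cup\{v\}$, $\tau$ a $(d-1)$-face of $\sigma$. A stacked $d$-sphere is a complex obtained from $S^d_{d+2}$ by finitely many such starrings. For $d\ge 2$, $\mathcal{K}(d)$ denotes the class of all $d$-dimensional normal pseudomanifolds in which the link of every vertex is a stacked $(d-1)$-sphere. *)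

(* Defs.v *)
From HB Require Import structures.
From mathcomp Require Import all_boot all_order all_algebra.
From mathcomp Require Import all_classical all_reals all_analysis.
From mathcomp Require Import Rstruct Rstruct_topology.
From Stdlib Require Import Reals.

Set Implicit Arguments.
Unset Strict Implicit.
Unset Printing Implicit Defensive.

Import Order.TTheory GRing.Theory Num.Theory.

Section Complexes.
Local Open Scope set_scope.
Variable T : finType.
Implicit Types (X Y F : {set {set T}}) (a b : {set T}).

Definition is_complex X : Prop :=
  forall a b, a \in X -> b \subset a -> b \in X.

Definition is_facet X a : Prop :=
  a \in X /\ forall b, b \in X -> a \subset b -> b = a.

(** pure d-dimensional complex: it has a d-face, and all facets are d-faces
    (a face of dimension i has i+1 elements) *)
Definition pure (d : nat) X : Prop :=
  is_complex X /\ (exists a, a \in X /\ #|a| = d.+1) /\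
  forall a, is_facet X a -> #|a| = d.+1.

Definition link X a : {set {set T}} :=
  [set b in X | [disjoint b & a] && (a :|: b \in X)].

Definition complex_connected Y : Prop :=
  forall u v, [set u] \in Y -> [set v] \in Y ->
    connect [rel x y | [set x; y] \in Y] u v.

Definition normal_pseudomanifold (d : nat) X : Prop :=
  1 <= d /\ pure d X /\
  (forall a, a \in X -> #|a| = d ->
      #|[set f in X | (#|f| == d.+1) && (a \subset f)]| = 2) /\
  (forall a, a \in X -> #|a| <= d - 1 -> complex_connected (link X a)).

Definition closure F : {set {set T}} :=
  [set a : {set T} | [exists f in F, a \subset f]].

(** facet sets of stacked d-spheres: start from the boundary of a
    (d+1)-simplex (facets S minus one point, #|S| = d+2), and repeatedly
    star a new vertex v in a facet s *)
Inductive stacked_facets (d : nat) : {set {set T}} -> Prop :=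
| stacked_base (S : {set T}) :
    #|S| = d.+2 -> stacked_facets d [set S :\ x | x in S]
| stacked_star (F : {set {set T}}) (s : {set T}) (v : T) :
    stacked_facets d F -> s \in F -> (forall f, f \in F -> v \notin f) ->
    stacked_facets d ((F :\ s) :|: [set v |: (s :\ x) | x in s]).

Definition stacked_sphere (d : nat) X : Prop :=
  exists F, stacked_facets d F /\ X = closure F.

Definition in_K (d : nat) X : Prop :=
  2 <= d /\ normal_pseudomanifold d X /\
  forall v, [set v] \in X -> stacked_sphere d.-1 (link X [set v]).

End Complexes.

Local Open Scope classical_set_scope.
Local Open Scope ring_scope.

(** geometric realization of a complex on vertex set 'I_n, inside R^n:
    points of the standard simplex whose support is a face *)
Definition realization (n : nat) (X : {set {set 'I_n}}) : set 'rV[R]_n :=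
  [set p | (forall i, 0 <= p ord0 i) /\ \sum_(i < n) p ord0 i = 1 /\
           [set i | p ord0 i != 0]%SET \in X].

Definition I01 : set R := [set x : R | 0 <= x <= 1].

Definition path_in (n : nat) (A : set 'rV[R]_n) (g : R -> 'rV[R]_n) : Prop :=
  {within I01, continuous g} /\ (forall s, I01 s -> A (g s)).

Definition simply_connected (n : nat) (A : set 'rV[R]_n) : Prop :=
  (exists x, A x) /\
  (forall x y, A x -> A y ->
     exists g, path_in A g /\ g 0 = x /\ g 1 = y) /\
  (forall g, path_in A g -> g 0 = g 1 ->
     exists H : R * R -> 'rV[R]_n,
       {within I01 `*` I01, continuous H} /\
       (forall s t, I01 s -> I01 t -> A (H (s, t))) /\
       (forall s, I01 s -> H (s, 0) = g s /\ H (s, 1) = g 0) /\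
       (forall t, I01 t -> H (0, t) = g 0 /\ H (1, t) = g 0)).

(* Main.v *)
Require Import Defs.
From mathcomp Require Import all_boot all_order.
From mathcomp Require boolp.

(* Stacked spheres are simply connected because a closed walk in the graph can
   be pushed off the last starred vertex, and continuous loops are homotopic to
   walks.

   Conversely, let the vertex links of X be stacked and X simply connected. If
   the link of w is not the boundary of a simplex, the facet destroyed by its
   last starring, joined with w, is a (d+1)-set r which is not a face although
   all its proper subsets are (this uses d >= 4). In the link of each u in r,
   the graph minus r falls into exactly two sides; these sides define a
   Z/2-valued cocycle on the edges leaving r. As X has no first cohomology, the
   cocycle is a coboundary, so r separates the graph of X. A minimal side, over
   all such r, contains only vertices whose link is the boundary of a simplex S.
   Either S is a face and X is the boundary of a simplex, or replacing the star
   of such a vertex by the facet S undoes a starring; the resulting complex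
   inherits the hypotheses and has one vertex fewer. *)

Set Implicit Arguments.
Unset Strict Implicit.
Unset Printing Implicit Defensive.

(** * Stacked spheres *)

(** The two sides of [r] seen in the link of one vertex carry no canonical labels, so they do not
    glue by themselves. Labels at two vertices of [r] are compared in the link of their edge and
    differ there by a sign; these signs form a cocycle on the simplex [r] and are removed by
    normalizing at one vertex. Only then does a cocycle on the whole complex arise. The comparison
    takes place in a sphere of dimension d - 2, which must be at least 2; this is a second use of d
    >= 4.

    Simple connectivity is awkward to carry through the removal of a vertex. It is exchanged at the
    outset for the vanishing of the first cohomology mod 2, which passes along a simplicial map.
    Analysis enters only in this exchange and in the proof that stacked spheres are simply
    connected; both rest on labelling each point by a vertex whose coordinate is bounded below. *)

Ltac push_memberships z :=
  repeat match goal with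
  | H : is_true (_ \subset _) |- _ => move: {H} (subsetP H z)
  | H : is_true (_ \in _) |- _ => move: H
  | H : is_true (_ \notin _) |- _ => move: H
  | H : (_ \in _) = _ |- _ => move: H
  | H : is_true (_ != _) |- _ => move: H
  end.

Ltac split_atoms :=
  repeat match goal with
  | |- context [?x == ?y] => case: (eqVneq x y) => [?|?]; try subst; rewrite ?eqxx //=
  end;
  repeat match goal with |- context [?x \in ?A] => case: (x \in A) => //= end.

Ltac set_solve_at z :=
  push_memberships z; rewrite ?inE /=; split_atoms;
  try (by []); try (by move=> *; intuition congruence).

Ltac set_solve :=
  match goal with
  | |- is_true (_ \subset _) => let z := fresh "z" in apply/subsetP => z; set_solve_at z
  | |- @eq _ _ _ => let z := fresh "z" in apply/setP => z; set_solve_at z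
  end.

Section StackedSpheres.
Variable T : finType.
Implicit Types (X Y F : {set {set T}}) (a b f s S : {set T}) (v w x y : T).

Definition simplex_boundary S : {set {set T}} := [set b : {set T} | b \proper S].

(** Starring on all faces, whereas [stacked_facets] acts on facets: [v] is coned over the boundary
    of [s], and a facet [s] is the only face destroyed. *)
Definition starring X s v : {set {set T}} :=
  [set b : {set T} | if v \in b then b :\ v \proper s else (b \in X) && (b != s)].

(** Undoes a starring when the link of [w] is the boundary of [s] and [s] is not a face. *)
Definition unstarring X w s : {set {set T}} := s |: [set b in X | w \notin b].

Lemma in_closure F b : reflect (exists2 f, f \in F & b \subset f) (b \in Defs.closure F).
Proof. by rewrite inE; apply: (iffP exists_inP). Qed.

Lemma closure_complex F : is_complex (Defs.closure F).
Proof.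
move=> a b /in_closure [f fF af] ba; apply/in_closure; exists f => //.
exact: subset_trans ba af.
Qed.

Lemma proper_subD1 b S : b \proper S -> exists2 x, x \in S & b \subset S :\ x.
Proof.
move=> /properP [bS [x xS xb]]; exists x => //.
by rewrite subsetD1 bS.
Qed.

Lemma subD1_proper b S x : x \in S -> b \subset S :\ x -> b \proper S.
Proof. by move=> xS bSx; exact: sub_proper_trans bSx (properD1 xS). Qed.

Lemma proper_of_card b S : b \subset S -> #|b| < #|S| -> b \proper S.
Proof. by move=> bS lt; rewrite properEcard bS lt. Qed.

Lemma closure_base S : Defs.closure [set S :\ x | x in S] = simplex_boundary S.
Proof.
apply/setP=> b; rewrite inE [in RHS]inE; apply/exists_inP/idP.
  by move=> [f /imsetP [x xS ->]]; exact: subD1_proper.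
by move/proper_subD1 => [x xS bx]; exists (S :\ x) => //; apply/imsetP; exists x.
Qed.

Lemma stacked_facets_card d F f : stacked_facets d F -> f \in F -> #|f| = d.+1.
Proof.
move=> H; elim: H f => [S cS|{}F s v _ IH sF vF] f.
  by case/imsetP=> x xS ->; move: (cardsD1 x S); rewrite xS cS => -[].
case/setUP => [/setD1P [_ /IH]//|/imsetP [x xs ->]].
have vs := vF _ sF.
by rewrite cardsU1 !inE (negbTE vs) andbF add1n -(IH s sF) (cardsD1 x s) xs.
Qed.

Lemma closure_star d F s v : stacked_facets d F -> s \in F ->
  (forall f, f \in F -> v \notin f) ->
  Defs.closure ((F :\ s) :|: [set v |: (s :\ x) | x in s]) = starring (Defs.closure F) s v.
Proof.
move=> stF sF vF; apply/setP=> b; rewrite [in RHS]inE.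
have cF f : f \in F -> #|f| = d.+1 by exact: stacked_facets_card.
apply/in_closure/idP.
  case=> f /setUP [/setD1P [nfs fF] bf|/imsetP [x xs ->] bf].
    have vf := vF _ fF; have -> : (v \in b) = false.
      by apply/negP => /(subsetP bf); rewrite (negbTE vf).
    apply/andP; split; first by apply/in_closure; exists f.
    apply: contra_neq nfs => bs; apply/eqP; rewrite eq_sym -bs eqEcard bf /=.
    by rewrite bs !cF.
  have vs := vF _ sF; case: ifP => vb.
    by apply: (subD1_proper xs); set_solve.
  have bs : b \subset s :\ x.
    apply/subsetP => z zb; move/subsetP/(_ z zb): bf; rewrite !inE.
    by case: eqP zb => [->|//]; rewrite vb.
  rewrite andbC; have /proper_neq -> := subD1_proper xs bs.
  apply/in_closure; exists s => //; exact: subset_trans bs (subD1set _ _).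
case: ifP => vb.
  move/proper_subD1 => [x xs bx]; exists (v |: (s :\ x)).
    by apply/setUP; right; apply/imsetP; exists x.
  by rewrite -subDset.
case/andP=> /in_closure [f fF bf] nbs.
have [fs|nfs] := eqVneq f s.
  have : b \proper s by rewrite properEneq nbs -fs.
  case/proper_subD1=> x xs bx; exists (v |: (s :\ x)).
    by apply/setUP; right; apply/imsetP; exists x.
  by apply: subset_trans bx _; apply: subsetU1.
by exists f => //; rewrite !inE nfs fF.
Qed.

Lemma stacked_sphere_boundary d S : #|S| = d.+2 -> stacked_sphere d (simplex_boundary S).
Proof.
move=> cS; exists [set S :\ x | x in S]; split; first exact: stacked_base.
by rewrite closure_base.
Qed.

Lemma stacked_sphere_complex d X : stacked_sphere d X -> is_complex X.
Proof. by case=> F [_ ->]; exact: closure_complex. Qed.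

Lemma facet_of_closure d F s : stacked_facets d F -> s \in Defs.closure F ->
  #|s| = d.+1 -> s \in F.
Proof.
move=> stF /in_closure [f fF sf] cs; suff -> : s = f by [].
by apply/eqP; rewrite eqEcard sf (stacked_facets_card stF fF) cs leqnn.
Qed.

Lemma stacked_sphere_starring d X s v : stacked_sphere d X -> s \in X ->
  #|s| = d.+1 -> [set v] \notin X -> stacked_sphere d (starring X s v).
Proof.
case=> F [stF ->] sX cs vX; have sF := facet_of_closure stF sX cs.
have vF f : f \in F -> v \notin f.
  move=> fF; apply: contra vX => vf; apply/in_closure; exists f => //.
  by rewrite sub1set.
exists ((F :\ s) :|: [set v |: (s :\ x) | x in s]); split.
  exact: stacked_star.
by rewrite (closure_star stF).
Qed.

(** Replaces induction on facet sets by induction on complexes. The step also provides that the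
    complex before the starring is a stacked sphere, so that results already proved apply to it. *)
Lemma stacked_sphere_ind d (P : {set {set T}} -> Prop) :
  (forall S, #|S| = d.+2 -> P (simplex_boundary S)) ->
  (forall X s v, stacked_sphere d X -> P X -> s \in X -> #|s| = d.+1 ->
     [set v] \notin X -> P (starring X s v)) ->
  forall X, stacked_sphere d X -> P X.
Proof.
move=> P0 P1 X [F [stF ->]]; elim: stF => [S cS|{}F s v stF IH sF vF].
  by rewrite closure_base; exact: P0.
rewrite (closure_star stF) //; apply: P1 => //.
- by exists F.
- by apply/in_closure; exists s.
- exact: stacked_facets_card stF sF.
- apply/negP => /in_closure [f fF]; rewrite sub1set.
  by rewrite (negbTE (vF f fF)).
Qed.

Lemma fresh_notin X v b : is_complex X -> [set v] \notin X -> b \in X -> v \notin b.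
Proof.
move=> cX vX bX; apply: contra vX => vb; apply: cX bX _; by rewrite sub1set.
Qed.

Lemma in_link X v b : (b \in link X [set v]) = [&& b \in X, v \notin b & v |: b \in X].
Proof. by rewrite inE disjoint_sym disjoints1 setUC. Qed.

Lemma in_complex_link X v b : is_complex X ->
  (b \in link X [set v]) = (v \notin b) && (v |: b \in X).
Proof.
move=> cX; rewrite in_link; case vbX : (v |: b \in X); last by rewrite !andbF.
by rewrite (cX _ _ vbX) // subsetU1.
Qed.

End StackedSpheres.

(** * Missing faces, ridges and links of stacked spheres *)

Section StackedStructure.
Variable T : finType.
Implicit Types (X Y F : {set {set T}}) (a b f s S r : {set T}) (v w x y : T).

Lemma in_boundary S b : (b \in simplex_boundary S) = (b \proper S).
Proof. by rewrite inE. Qed.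

Lemma in_starring X s v b :
  (b \in starring X s v) =
  if v \in b then b :\ v \proper s else (b \in X) && (b != s).
Proof. by rewrite inE. Qed.

Lemma in_unstarring X w s b :
  (b \in unstarring X w s) = (b == s) || (b \in X) && (w \notin b).
Proof. by rewrite !inE. Qed.

Lemma proper_add1_self x S b : x \in S -> x \notin b ->
  (x |: b \proper S) = (b \proper S :\ x).
Proof.
move=> xS xb; rewrite !properE subUset sub1set xS /= subsetD1 xb andbT.
by rewrite -subDset.
Qed.

Lemma card_setD1 x S n : x \in S -> #|S| = n.+1 -> #|S :\ x| = n.
Proof. by move=> xS; rewrite (cardsD1 x S) xS => -[]. Qed.

Lemma card_setU1 x S n : x \notin S -> #|S| = n -> #|x |: S| = n.+1.
Proof. by move=> xS; rewrite cardsU1 xS => ->. Qed.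

Lemma eq_of_sub_card a b : a \subset b -> #|b| <= #|a| -> a = b.
Proof. by move=> ab cba; apply/eqP; rewrite eqEcard ab. Qed.

Lemma proper_set_one x s : 1 < #|s| -> ([set x] \proper s) = (x \in s).
Proof.
move=> cs; rewrite properE sub1set; apply: andb_idr => _.
by apply: contraL cs => /subset_leq_card; rewrite cards1 leqNgt.
Qed.

Lemma exists_notin s S : #|S| < #|s| -> exists2 x, x \in s & x \notin S.
Proof.
move=> cS; have : ~~ (s \subset S).
  by apply: contraL cS => /subset_leq_card; rewrite -leqNgt.
by case/subsetPn=> x; exists x.
Qed.

Lemma starring_face0 X s v b : v \notin b ->
  (b \in starring X s v) = (b \in X) && (b != s).
Proof. by move=> vb; rewrite in_starring (negbTE vb). Qed.

Lemma starring_face1 X s v b : v \notin b ->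
  (v |: b \in starring X s v) = (b \proper s).
Proof. by move=> vb; rewrite in_starring setU11 setU1K. Qed.

(** A starring destroys [s], and here [s] would be a proper subset of [S]. If [v] is in [S], the
    faces through [v] force [s = S :\ v]; otherwise the boundary is present before the starring, and
    by induction [s] is one of its faces. *)
Lemma boundary_sub_eq m X S : 0 < m -> stacked_sphere m X -> #|S| = m.+2 ->
  simplex_boundary S \subset X -> X = simplex_boundary S.
Proof.
move=> m0 stX cS; elim/stacked_sphere_ind: stX => [S' cS'|{}X s v stX IH sX cs vX] sub.
  suff -> : S = S' by [].
  apply: eq_of_sub_card; last by rewrite cS cS'.
  apply/subsetP => x xS.
  have: [set x] \in simplex_boundary S by rewrite in_boundary proper_set_one // cS.
  by move/(subsetP sub); rewrite in_boundary proper_set_one // cS'.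
have cX := stacked_sphere_complex stX.
have vs : v \notin s := fresh_notin cX vX sX.
have sN : s \notin starring X s v by rewrite starring_face0 // eqxx andbF.
have [vS|vS] := boolP (v \in S).
  suff E : s = S :\ v.
    by case/negP: sN; apply: (subsetP sub); rewrite in_boundary E properD1.
  apply/esym/eq_of_sub_card; last by rewrite cs (card_setD1 vS cS).
  apply/subsetP => x; rewrite !inE => /andP [xv xS].
  have [y] : exists2 y, y \in S & y \notin [set v; x].
    by apply: exists_notin; rewrite cS cards2; case: eqP => //= _; rewrite ltnS ltnS.
  rewrite !inE negb_or => yS /andP [yv yx].
  have : S :\ y \in simplex_boundary S by rewrite in_boundary properD1.
  move/(subsetP sub); rewrite in_starring !inE eq_sym yv vS /=.
  by move/proper_sub/subsetP/(_ x); apply; rewrite !inE xv xS eq_sym yx.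
have E : X = simplex_boundary S.
  apply: IH; apply/subsetP => b bS; move/subsetP/(_ b bS): sub.
  move: bS; rewrite in_boundary => /proper_sub/subsetP bS.
  rewrite starring_face0; last by apply: contra vS; exact: bS.
  by case/andP.
case/negP: sN; apply: (subsetP sub); rewrite -E; exact: sX.
Qed.

(** Faces through the new vertex [v] are [v] joined to proper subsets of [s]. Three elements in [r]
    suffice to force [r :\ v] into [s], and [#|r| <= m] makes the inclusion proper. Size 2 is a
    genuine exception: [v] and an old vertex outside [s] span no edge. *)
Lemma no_small_missing_face m X r : stacked_sphere m X ->
  2 < #|r| <= m -> (forall x, x \in r -> r :\ x \in X) -> r \in X.
Proof.
move=> stX /andP [c2 cm]; elim/stacked_sphere_ind: stX => [S cS|{}X s v stX IH sX cs vX] H.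
  rewrite in_boundary; apply: proper_of_card; last by rewrite cS ltnS (leq_trans cm).
  apply/subsetP => x xr.
  have [y yr] : exists2 y, y \in r & y \notin [set x].
    by apply: exists_notin; rewrite cards1 ltnW.
  rewrite !inE => yx; move: (H _ yr); rewrite in_boundary => /proper_sub/subsetP.
  by apply; rewrite !inE xr eq_sym yx.
have cX := stacked_sphere_complex stX.
have vs : v \notin s := fresh_notin cX vX sX.
have crs : #|r| < #|s| by rewrite cs ltnS.
rewrite in_starring; case: ifP => vr.
  apply: proper_of_card; last first.
    by apply: leq_ltn_trans crs; apply: subset_leq_card; exact: subD1set.
  apply/subsetP => x; rewrite !inE => /andP [xv xr].
  have [y yr] : exists2 y, y \in r & y \notin [set x; v].
    by apply: exists_notin; rewrite cards2 xv.
  rewrite !inE negb_or => /andP [yx yv]; move: (H _ yr).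
  rewrite in_starring !inE eq_sym yv vr /= => /proper_sub/subsetP; apply.
  by rewrite !inE xv xr eq_sym yx.
apply/andP; split; last by apply: contraTneq crs => ->; rewrite ltnn.
apply: IH => x xr; move: (H _ xr); rewrite in_starring !inE vr andbF.
by case/andP.
Qed.

(** If the facet across the ridge was the destroyed [s], then [v] takes over. If [f] contains [v],
    so that [f :\ v = s :\ y], the new vertex is [y] for [x != v], and the old neighbour of [s]
    across [s :\ y] for [x = v]. *)
Lemma ridge_other_facet m X f x : stacked_sphere m X -> f \in X -> #|f| = m.+1 ->
  x \in f -> exists2 a, a \notin f & a |: (f :\ x) \in X.
Proof.
move=> stX; elim/stacked_sphere_ind: stX f x => [S cS|{}X s v stX IH sX cs vX] f x fX cf xf.
  move: fX; rewrite in_boundary => /properP [fS [a aS af]]; exists a => //.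
  rewrite in_boundary properE subUset sub1set aS (subset_trans (subD1set _ _) fS) /=.
  apply/subsetPn; exists x; first exact: (subsetP fS).
  by rewrite !inE eqxx /= orbF; apply: contraTneq xf => ->.
have cX := stacked_sphere_complex stX.
have vs : v \notin s := fresh_notin cX vX sX.
have [vf|vf] := boolP (v \in f).
  move: fX; rewrite in_starring vf => /properP [fs [y ys yf]].
  have yNf : y \notin f.
    by apply: contra yf => yf; rewrite !inE yf andbT; apply: contraNneq vs => <-.
  have E : f :\ v = s :\ y.
    apply: eq_of_sub_card.
      by rewrite subsetD1 fs.
    by rewrite (card_setD1 vf cf) (card_setD1 ys cs).
  have [->|xv] := eqVneq x v.
    have [a aNs aX] := IH s y sX cs ys; rewrite E; exists a.
      apply: contra aNs => af; have [->|yNa] := eqVneq a y; first exact: ys.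
      apply: (subsetP fs); rewrite !inE af andbT; apply: contraNneq vX => <-.
      by apply: cX aX _; rewrite sub1set setU11.
    rewrite starring_face0; last exact: (fresh_notin cX).
    by rewrite aX /=; apply: contraNneq aNs => <-; rewrite setU11.
  exists y => //; rewrite in_starring !inE vf (eq_sym v x) xv orbT.
  apply: (@subD1_proper _ _ _ x).
    by apply: (subsetP fs); rewrite !inE xv.
  have yx : y != x by apply: contraNneq yNf => ->.
  apply/subsetP => z; rewrite !inE => /andP [zv /orP [/eqP ->|/andP [zx zf]]].
    by rewrite yx ys.
  by rewrite zx; apply: (subsetP fs); rewrite !inE zv.
move: fX; rewrite starring_face0 // => /andP [fX nfs].
have [a aNf aX] := IH f x fX cf xf.
have [E|nE] := eqVneq (a |: (f :\ x)) s; last first.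
  exists a => //; rewrite starring_face0 ?aX ?nE //; exact: (fresh_notin cX).
exists v => //; rewrite starring_face1; last by rewrite !inE (negbTE vf) andbF.
rewrite -E properE subsetU1 /=; apply/subsetPn; exists a; rewrite ?setU11 //.
by rewrite !inE (negbTE aNf) andbF.
Qed.

(** A starring acts on the link of [v] in three ways: for a new [v] the link is the boundary of [s];
    for [v] in [s] the old link is starred in [s :\ v]; otherwise nothing changes. *)
Lemma link_stacked m X v : stacked_sphere m.+1 X -> [set v] \in X ->
  stacked_sphere m (link X [set v]).
Proof.
move=> stX; elim/stacked_sphere_ind: stX => [S cS|{}X s w stX IH sX cs wX] vX.
  have vS : v \in S by move: vX; rewrite in_boundary => /proper_sub; rewrite sub1set.
  suff -> : link (simplex_boundary S) [set v] = simplex_boundary (S :\ v).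
    by apply: stacked_sphere_boundary; exact: card_setD1.
  apply/setP => b; rewrite in_complex_link; last first.
    by apply: stacked_sphere_complex; exact: stacked_sphere_boundary cS.
  rewrite !in_boundary; have [vb|vb] /= := boolP (v \in b).
    by apply/esym/negP => /proper_sub /subsetP /(_ v vb); rewrite !inE eqxx.
  by rewrite proper_add1_self.
have cX := stacked_sphere_complex stX.
have ws : w \notin s := fresh_notin cX wX sX.
have cX' : is_complex (starring X s w).
  by apply: stacked_sphere_complex; exact: stacked_sphere_starring stX sX cs wX.
have [E|vw] := eqVneq v w.
  suff -> : link (starring X s w) [set v] = simplex_boundary s.
    exact: stacked_sphere_boundary.
  apply/setP => b; rewrite in_complex_link // in_boundary E.
  have [wb|wb] /= := boolP (w \in b); last exact: starring_face1.
  by apply/esym/negP => /proper_sub /subsetP /(_ w wb); rewrite (negbTE ws).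
have {}vX : [set v] \in X.
  by move: vX; rewrite starring_face0 => [/andP [] //|]; rewrite !inE eq_sym.
have wv : w != v by rewrite eq_sym.
have cL := stacked_sphere_complex (IH vX).
have wL : [set w] \notin link X [set v].
  apply: contra wX; rewrite in_link; by case/andP.
have [vs|vs] := boolP (v \in s).
  suff -> : link (starring X s w) [set v] = starring (link X [set v]) (s :\ v) w.
    apply: stacked_sphere_starring (IH vX) _ _ wL.
      by rewrite in_complex_link // !inE eqxx setD1K.
    exact: card_setD1.
  apply/setP => b; rewrite in_complex_link // !in_starring in_complex_link //.
  have [vb|vb] /= := boolP (v \in b).
    case: ifP => // wb; apply/esym/negP => /proper_sub /subsetP /(_ v).
    by rewrite !inE vb vw eqxx => /(_ isT).
  rewrite !inE (negbTE wv) /=; case: ifP => wb.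
    rewrite -proper_add1_self //; last by rewrite !inE (negbTE vb) andbF.
    by have -> : (v |: b) :\ w = v |: (b :\ w) by set_solve.
  congr (_ && _); congr negb; apply/eqP/eqP => [<-|->].
    by rewrite setU1K.
  by rewrite setD1K.
suff -> : link (starring X s w) [set v] = link X [set v] by exact: IH.
apply/setP => b; rewrite !in_complex_link // in_starring.
have [vb|vb] //= := boolP (v \in b); rewrite !inE (negbTE wv) /=.
case: ifP => wb.
  transitivity false.
    apply/negP => /proper_sub /subsetP /(_ v); rewrite !inE vw eqxx => /(_ isT).
    exact/negP.
  apply/esym/negP => bX; case/negP: (fresh_notin cX wX bX).
  by rewrite !inE wb orbT.
by apply: andb_idr => _; apply: contraNneq vs => <-; rewrite setU11.
Qed.

End StackedStructure.

(** * Separation of the graph by facets and by missing facets *)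

Section Separation.
Variable T : finType.
Implicit Types (X Y F : {set {set T}}) (a b f s S r : {set T}) (v w x y : T).
Implicit Types (t : T -> bool).

(** Components are handled through Boolean functions instead of paths: outside [r], such a [t]
    selects a union of components of the remaining graph. *)
Definition edge_constant_off X r t : Prop :=
  forall x y, [set x; y] \in X -> x \notin r -> y \notin r -> t x = t y.

Lemma starring_edge X s v x : 1 < #|s| -> v \notin s -> x \in s ->
  [set v; x] \in starring X s v.
Proof.
by move=> cs vs xs; rewrite starring_face1 ?proper_set_one // inE; apply: contraNneq vs => ->.
Qed.

Lemma starring_old_edge X s v x y : 2 < #|s| -> v \notin [set x; y] ->
  ([set x; y] \in starring X s v) = ([set x; y] \in X).
Proof.
move=> cs vxy; rewrite starring_face0 //; apply: andb_idr => _.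
by apply: contraTneq cs => <-; rewrite cards2; case: eqP.
Qed.

Lemma edge_constant_starring X s v r t : 2 < #|s| -> is_complex X -> [set v] \notin X ->
  edge_constant_off (starring X s v) r t -> edge_constant_off X r t.
Proof.
move=> cs cX vX H x y xyX; apply: H; rewrite starring_old_edge //.
exact: fresh_notin xyX.
Qed.

(** A new vertex outside [f] is tied to the old ones by an element of [s] outside [f]. If [v] is in
    [f], the complement of [f] is that of the destroyed facet [s] plus one vertex [y] of [s]; the
    induction therefore runs over all facets. *)
Lemma constant_off_facet m X f t : 1 < m -> stacked_sphere m X -> f \in X ->
  #|f| = m.+1 -> edge_constant_off X f t ->
  exists c, forall x, [set x] \in X -> x \notin f -> t x = c.
Proof.
move=> m1 stX; elim/stacked_sphere_ind: stX f => [S cS|{}X s v stX IH sX cs vX] f fX cf tf.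
  move: fX; rewrite in_boundary => /properP [fS [y yS yf]].
  have E : S = y |: f.
    apply/esym/eq_of_sub_card; first by rewrite subUset sub1set yS.
    by rewrite (card_setU1 yf cf) cS.
  exists (t y) => x; rewrite in_boundary => /proper_sub; rewrite sub1set E !inE.
  by case/orP => [/eqP -> //|->].
have cX := stacked_sphere_complex stX.
have vs : v \notin s := fresh_notin cX vX sX.
have c2 : 2 < #|s| by rewrite cs.
have tX : edge_constant_off X f t by exact: edge_constant_starring tf.
have vert x : [set x] \in starring X s v -> x != v -> [set x] \in X.
  by move=> xX xv; move: xX; rewrite starring_face0 ?inE 1?eq_sym // => /andP [].
have [vf|vf] := boolP (v \in f); last first.
  move: fX; rewrite starring_face0 // => /andP [fX nfs].
  have [c Hc] := IH f fX cf tX; exists c => x xX xf.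
  have [E|xv] := eqVneq x v; last by apply: Hc => //; exact: vert.
  have [y ys yf] : exists2 y, y \in s & y \notin f.
    have : ~~ (s \subset f).
      by apply: contra nfs => sf; rewrite eq_sym; apply/eqP/eq_of_sub_card; rewrite ?cs ?cf.
    by case/subsetPn => y; exists y.
  rewrite E (tf v y) //; last by apply: starring_edge => //; exact: ltnW.
  by apply: Hc => //; apply: cX sX _; rewrite sub1set.
move: fX; rewrite in_starring vf => /properP [fs [y ys yf]].
have yNv : y != v by apply: contraNneq vs => <-.
have yNf : y \notin f by apply: contra yf => yf; rewrite !inE yf yNv.
have fsy x : x \in s -> x \notin f -> x = y.
  have E : f :\ v = s :\ y.
    by apply: eq_of_sub_card; rewrite ?subsetD1 ?fs // (card_setD1 vf cf) (card_setD1 ys cs).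
  move=> xs xf; apply/eqP; apply: contraNT xf => xy.
  have : x \in f :\ v by rewrite E !inE xy.
  by rewrite !inE => /andP [].
have [c Hc] : exists c, forall x, [set x] \in X -> x \notin s -> t x = c.
  apply: (IH s sX cs) => x x' xxX xs x's; apply: tX => //.
    apply: contra xs => xf; apply: (subsetP fs); rewrite !inE xf andbT.
    apply: contraNneq (fresh_notin cX vX xxX) => <-; by rewrite !inE eqxx.
  apply: contra x's => xf; apply: (subsetP fs); rewrite !inE xf andbT.
  apply: contraNneq (fresh_notin cX vX xxX) => <-; by rewrite !inE eqxx orbT.
exists c => x xX xf.
have xv : x != v by apply: contraNneq xf => ->.
have {}xX := vert x xX xv.
have [xs|xs] := boolP (x \in s); last exact: Hc.
have E := fsy x xs xf; rewrite {}E {x} in xf xX xv xs *.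
(* The ridge [s :\ z] contains [y], and the facet across it supplies a neighbour [a] of [y] outside
   [s]. *)
have [z zs] : exists2 z, z \in s & z \notin [set y].
  by apply: exists_notin; rewrite cards1 ltnW.
rewrite !inE => zy.
have [a aNs aX] := ridge_other_facet stX sX cs zs.
have aX1 : [set a] \in X by apply: cX aX _; rewrite sub1set setU11.
have yaX : [set y; a] \in X.
  by apply: cX aX _; rewrite subUset !sub1set setU11 !inE (eq_sym y z) zy ys orbT.
rewrite (tX y a) //; first exact: Hc.
apply: contra aNs => af; apply: (subsetP fs); rewrite !inE af andbT.
by apply: contraNneq vX => <-.
Qed.

(* The second clause says that each of the two sides given by [t] is connected. *)
Lemma missing_facet_sides m X r : 1 < m -> stacked_sphere m X -> #|r| = m.+1 ->
  r \notin X -> (forall x, x \in r -> r :\ x \in X) ->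
  exists t, [/\ edge_constant_off X r t,
    (forall t', edge_constant_off X r t' -> exists c0 c1 : bool,
       forall x, [set x] \in X -> x \notin r -> t' x = if t x then c1 else c0) &
    (forall x (c : bool), x \in r ->
       exists y, [/\ y \notin r, y |: (r :\ x) \in X & t y = c])].
Proof.
move=> m1 stX cr; elim/stacked_sphere_ind: stX => [S cS|{}X s v stX IH sX cs vX] rX H.
  case/negP: rX; rewrite in_boundary; apply: proper_of_card; last by rewrite cr cS.
  apply/subsetP => x xr.
  have [y yr] : exists2 y, y \in r & y \notin [set x].
    by apply: exists_notin; rewrite cards1 cr ltnS ltnW.
  rewrite !inE => yx; move: (H _ yr); rewrite in_boundary => /proper_sub/subsetP.
  by apply; rewrite !inE xr eq_sym yx.
have cX := stacked_sphere_complex stX.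
have vs : v \notin s := fresh_notin cX vX sX.
have c2 : 2 < #|s| by rewrite cs.
have vert x : [set x] \in starring X s v -> x != v -> [set x] \in X.
  by move=> xX xv; move: xX; rewrite starring_face0 ?inE 1?eq_sym // => /andP [].
have nbr x : [set v; x] \in starring X s v -> x != v -> x \in s.
  move=> vxX xv; move: vxX; rewrite starring_face1 ?inE 1?eq_sym // proper_set_one //.
  exact: ltnW.
have old_edge x y : x != v -> y != v -> [set x; y] \in starring X s v -> [set x; y] \in X.
  by move=> xv yv; rewrite starring_old_edge // !inE negb_or !(eq_sym v) xv.
(* If [r] contained [v], its proper subsets would force [r :\ v], of size [m], into [s], of size
   [m + 1], and [r] would be a face. *)
have vr : v \notin r.
  apply/negP => vr; case/negP: rX; rewrite in_starring vr.
  apply: proper_of_card; last by rewrite (card_setD1 vr cr) cs.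
  apply/subsetP => x; rewrite !inE => /andP [xv xr].
  have [y yr] : exists2 y, y \in r & y \notin [set x; v].
    by apply: exists_notin; rewrite cards2 xv cr ltnS.
  rewrite !inE negb_or => /andP [yx yv]; move: (H _ yr).
  rewrite in_starring !inE eq_sym yv vr /= => /proper_sub/subsetP; apply.
  by rewrite !inE xv xr eq_sym yx.
(* When the missing face is the destroyed facet, one side is the new vertex alone; the other
   consists of the old vertices, connected by [constant_off_facet]. *)
have [E|rs] := eqVneq r s.
  rewrite {IH}E {r cr rX vr} in H *; exists (pred1 v); split.
  - move=> x y xyX xs ys /=; have [E|xv] := eqVneq x v; have [E'|yv] := eqVneq y v => //.
      by move: xyX; rewrite E => /nbr/(_ yv); rewrite (negbTE ys).
    by move: xyX; rewrite E' setUC => /nbr/(_ xv); rewrite (negbTE xs).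
  - move=> t' Ht'.
    have [c Hc] := constant_off_facet m1 stX sX cs (edge_constant_starring c2 cX vX Ht').
    exists c, (t' v) => x xX xs /=; case: eqVneq => [-> //|xv].
    by apply: Hc => //; exact: vert.
  - move=> x [] xs; last first.
      have [a aNs aX] := ridge_other_facet stX sX cs xs.
      exists a; split=> //.
        rewrite starring_face0 ?aX /=; last exact: fresh_notin aX.
        by apply: contraNneq aNs => <-; rewrite setU11.
      by apply/negbTE; apply: contraNneq vX => <-; apply: cX aX _; rewrite sub1set setU11.
    exists v; split => //=; last by rewrite eqxx.
    by rewrite starring_face1 ?properD1 // !inE (negbTE vs) andbF.
have [y ys yr] : exists2 y, y \in s & y \notin r.
  have : ~~ (s \subset r).
    by apply: contra rs => sr; rewrite eq_sym; apply/eqP/eq_of_sub_card; rewrite ?cs ?cr.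
  by case/subsetPn => y; exists y.
have yX : [set y] \in X by apply: cX sX _; rewrite sub1set.
have yv : y != v by apply: contraNneq vs => <-.
have rX' : r \notin X by move: rX; rewrite starring_face0 // rs andbT.
have [|t [t1 t2 t3]] := IH rX'.
  move=> x xr; move: (H x xr); rewrite starring_face0; first by case/andP.
  by rewrite !inE (negbTE vr) andbF.
(* [v] joins the side of [y]. Its neighbours outside [r] lie with [y] in the old face [s], hence on
   the same side. *)
pose t' x := if x == v then t y else t x.
have t'v : t' v = t y by rewrite /t' eqxx.
have t'N x : x != v -> t' x = t x by rewrite /t' => /negbTE ->.
have t'nbr x : [set v; x] \in starring X s v -> x \notin r -> t' x = t y.
  move=> vxX xr; have [->//|xv] := eqVneq x v; rewrite t'N //.
  apply: t1 => //; apply: cX sX _; rewrite subUset !sub1set ys andbT.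
  exact: nbr.
exists t'; split.
- move=> x z xzX xr zr; have [E|xv] := eqVneq x v.
    by move: xzX; rewrite E t'v => /t'nbr ->.
  have [E|zv] := eqVneq z v; first by move: xzX; rewrite E t'v setUC => /t'nbr ->.
  rewrite !t'N //; apply: t1 => //; exact: old_edge.
- move=> u Hu; have [c0 [c1 Hc]] := t2 u (edge_constant_starring c2 cX vX Hu).
  exists c0, c1 => x xX xr; have [E|xv] := eqVneq x v.
    rewrite E t'v (Hu v y) //; first exact: Hc.
    by apply: starring_edge => //; exact: ltnW.
  by rewrite t'N //; apply: Hc => //; exact: vert.
- move=> x c xr; have [a [ar aX ta]] := t3 x c xr.
  have va : v \notin a |: (r :\ x) := fresh_notin cX vX aX.
  have av : a != v by apply: contraNneq va => <-; rewrite setU11.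
  (* If the facet on the requested side was destroyed, [v] replaces [a]; in that case [y] is the
     only vertex of [s] outside [r], so [a = y] and the side is kept. *)
  have [E|ns] := eqVneq (a |: (r :\ x)) s; last first.
    by exists a; split; rewrite ?t'N // starring_face0 // aX.
  exists v; split => //.
    rewrite starring_face1; last by rewrite !inE (negbTE vr) andbF.
    rewrite -E properE subsetU1 /=; apply/subsetPn; exists a; rewrite ?setU11 //.
    by rewrite !inE (negbTE ar) andbF.
  rewrite t'v -ta; congr t; move: ys; rewrite -E !inE.
  by case/orP => [/eqP //|/andP [_]]; rewrite (negbTE yr).
Qed.

(** The vertex [w] need not be the last one starred. If it is, that starring is undone; otherwise
    the last starring avoids the star of [w] and commutes with the removal, except when it destroys
    [r] itself. *)
Lemma unstarring_stacked m X w r : 1 < m -> stacked_sphere m X -> #|r| = m.+1 ->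
  w \notin r -> r \notin X ->
  (forall b, w \notin b -> (w |: b \in X) = (b \proper r)) ->
  stacked_sphere m (unstarring X w r).
Proof.
move=> m1 stX cr wr; have c2 : 2 < #|r| by rewrite cr.
have c1 : 1 < #|r| by exact: ltnW.
elim/stacked_sphere_ind: stX => [S cS|{}X s v stX IH sX cs vX] rX H.
  have wS : w \in S.
    have : w |: set0 \in simplex_boundary S.
      by rewrite H ?inE // proper0 -card_gt0 (ltn_trans _ c1).
    by rewrite in_boundary setU0 => /proper_sub; rewrite sub1set.
  case/negP: rX; rewrite in_boundary; apply: proper_of_card; last by rewrite cr cS.
  apply/subsetP => x xr; have wx : w \notin [set x].
    by rewrite inE; apply: contraNneq wr => ->.
  have : w |: [set x] \in simplex_boundary S by rewrite H // proper_set_one.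
  by rewrite in_boundary => /proper_sub; rewrite subUset !sub1set => /andP [].
have cX := stacked_sphere_complex stX.
have vs : v \notin s := fresh_notin cX vX sX.
have cs1 : 1 < #|s| by rewrite cs ltnS ltnW.
have [E|vw] := eqVneq v w.
  rewrite -{}E in wr H *.
  have E : r = s.
    apply: eq_of_sub_card; last by rewrite cr cs.
    apply/subsetP => x xr; have vx : v \notin [set x].
      by rewrite inE; apply: contraNneq wr => ->.
    by move: (H _ vx); rewrite starring_face1 // !proper_set_one // xr.
  suff -> : unstarring (starring X s v) v r = X by [].
  apply/setP => b; rewrite in_unstarring in_starring E; have [->|bs] /= := eqVneq b s.
    by rewrite sX.
  case: ifP => vb; rewrite ?andbF /= ?andbT //.
  by apply/esym/negP => /(fresh_notin cX vX); rewrite vb.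
have wX : [set w] \in X.
  have : w |: set0 \in starring X s v.
    by rewrite H ?inE // proper0 -card_gt0 (ltn_trans _ c1).
  by rewrite setU0 starring_face0 ?inE // => /andP [].
have sN : s \notin starring X s v by rewrite starring_face0 // eqxx andbF.
have [ws|ws] := boolP (w \in s).
  (* With [w] in [s], the prescribed link of [w] gives [s :\ w = r :\ v], which makes the destroyed
     [s] a face. *)
  case/negP: sN.
  have vr : v \in r.
    have wv : w \notin [set v] by rewrite inE eq_sym.
    have vw' : v \notin [set w] by rewrite inE.
    by rewrite -(proper_set_one v c1) -(H _ wv) setUC starring_face1 // proper_set_one.
  have sub : s :\ w \subset r :\ v.
    apply/subsetP => x; rewrite !inE => /andP [xw xs].
    have xv : x != v by apply: contraNneq vs => <-.
    have wvx : w \notin [set v; x] by rewrite !inE negb_or eq_sym vw eq_sym xw.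
    have : w |: [set v; x] \in starring X s v.
      have -> : w |: [set v; x] = v |: [set w; x] by rewrite setUCA.
      rewrite starring_face1; last by rewrite !inE negb_or vw eq_sym xv.
      apply: proper_of_card; first by rewrite subUset !sub1set ws.
      by rewrite cs cards2; case: eqP => _ //; exact: ltnW.
    rewrite H // => /proper_sub; rewrite subUset !sub1set xv => /andP [_ ->] //.
  have E : s :\ w = r :\ v.
    apply: eq_of_sub_card sub _.
    by rewrite (card_setD1 ws cs) (card_setD1 vr cr).
  suff : w |: (s :\ w) \in starring X s v by rewrite setD1K.
  rewrite H; last by rewrite !inE eqxx.
  by rewrite E properD1.
have vr : v \notin r.
  apply: contra ws => vr.
  have : w |: [set v] \in starring X s v.
    by rewrite H ?proper_set_one // inE eq_sym.
  by rewrite setUC starring_face1 ?proper_set_one // inE.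
have HX b : w \notin b -> (w |: b \in X) = (b \proper r).
  move=> wb; have [vb|vb] := boolP (v \in b).
    transitivity false.
      by apply/negP => /(fresh_notin cX vX); rewrite !inE vb orbT.
    by apply/esym/negP => /proper_sub/subsetP/(_ v vb); rewrite (negbTE vr).
  rewrite -H // starring_face0; last by rewrite !inE negb_or vw.
  by apply/esym/andb_idr => _; apply: contraNneq ws => <-; rewrite setU11.
(* If [r] was a face before the starring, then [r = s] and [X] is the boundary of [w |: r]; starring
   [v] and removing [w] merely exchange the apex. *)
have [rIX|rNX] := boolP (r \in X).
  have rs : r = s by apply/eqP; move: rX; rewrite starring_face0 // rIX negbK.
  have EX : X = simplex_boundary (w |: r).
    apply: boundary_sub_eq (ltnW m1) stX (card_setU1 wr cr) _.
    apply/subsetP => b; rewrite in_boundary; have [wb|wb] := boolP (w \in b).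
      move=> bwr; rewrite -(setD1K wb) HX ?inE ?eqxx //.
      by rewrite -(setU1K wr) -proper_add1_self ?setU11 ?setD1K // !inE eqxx.
    move/proper_sub => bwr; apply: cX rIX _; apply/subsetP => z zb.
    move/subsetP/(_ z zb): bwr; rewrite !inE => /orP [/eqP E|//].
    by move: wb; rewrite -E zb.
  suff -> : unstarring (starring X s v) w r = simplex_boundary (v |: r).
    by apply: stacked_sphere_boundary; exact: card_setU1.
  apply/setP => b; rewrite in_unstarring in_starring in_boundary -rs.
  have [->|br] /= := eqVneq b r.
    by apply/esym; rewrite properE subsetU1 /=; apply/subsetPn; exists v; rewrite ?setU11.
  have wvr : w \notin v |: r by rewrite !inE negb_or eq_sym vw.
  rewrite andbT; case: ifP => vb.
    have E : (b \proper v |: r) = (b :\ v \proper r).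
      rewrite -[in LHS](setD1K vb) proper_add1_self ?setU11 ?setU1K //.
      by rewrite !inE eqxx.
    rewrite E; apply: andb_idr => /proper_sub bvr; apply: contra wvr => wb.
    rewrite !inE eq_sym (negbTE vw) /=; apply: (subsetP bvr).
    by rewrite !inE wb eq_sym vw.
  rewrite EX in_boundary; apply/andP/idP => [[bwr wb]|].
    apply: proper_of_card.
      apply: subset_trans (subsetU1 _ _); move/proper_sub: bwr => bwr.
      apply/subsetP => z zb; move/subsetP/(_ z zb): bwr; rewrite !inE.
      by case/orP => [/eqP E|//]; move: wb; rewrite -E zb.
    move/proper_card: bwr; by rewrite !cardsU1 wr vr.
  move=> /proper_sub bvr; have brr : b \subset r.
    apply/subsetP => z zb; move/subsetP/(_ z zb): bvr; rewrite !inE.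
    by case/orP => [/eqP E|//]; move: vb; rewrite -E zb.
  split; last by apply: contra wr => /(subsetP brr).
  apply: sub_proper_trans brr _; rewrite properE subsetU1 /=.
  by apply/subsetPn; exists w; rewrite ?setU11.
have rs : r != s by apply: contraNneq rNX => ->.
have -> : unstarring (starring X s v) w r = starring (unstarring X w r) s v.
  apply/setP => b; rewrite in_unstarring !in_starring in_unstarring.
  have [->|br] /= := eqVneq b r; first by rewrite (negbTE vr) rs.
  case: ifP => vb; last by rewrite andbAC.
  apply: andb_idr => /proper_sub bs; apply: contra ws => wb; apply: (subsetP bs).
  by rewrite !inE wb eq_sym vw.
apply: stacked_sphere_starring (IH rNX HX) _ cs _.
  by rewrite in_unstarring sX ws orbT.
rewrite in_unstarring (negbTE vX) /= orbF.
by apply: contraNneq vr => <-; rewrite set11.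
Qed.

End Separation.

(** * Complexes with stacked vertex links *)

Section LocallyStacked.
Variable T : finType.
Implicit Types (X Y : {set {set T}}) (a b r S C : {set T}) (u v w x y z : T).

(** Degenerate triples are included; they make [c] symmetric on edges and zero on the diagonal. *)
Definition Z2_cocycle X (c : T -> T -> bool) : Prop :=
  forall x y z, [set x; y; z] \in X -> c x y (+) c y z = c x z.

(** Vanishing of the first simplicial cohomology with coefficients Z/2. *)
Definition Z2_acyclic X : Prop :=
  forall c, Z2_cocycle X c ->
    exists f : T -> bool, forall x y, [set x; y] \in X -> c x y = f x (+) f y.

Definition edge_connected X : Prop :=
  forall f : T -> bool, (forall x y, [set x; y] \in X -> f x = f y) ->
    forall x y, [set x] \in X -> [set y] \in X -> f x = f y.

(** With [Z2_acyclic] and [edge_connected], the invariant of the induction on vertices, for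
    dimension [m + 1]. *)
Definition locally_stacked m X : Prop :=
  is_complex X /\ forall v, [set v] \in X -> stacked_sphere m (link X [set v]).

Lemma cards2_le x y : #|[set x; y]| <= 2.
Proof. by rewrite cards2; case: eqP. Qed.

Lemma cards3_le x y z : #|[set x; y; z]| <= 3.
Proof.
rewrite setUC cardsU1 (leq_trans (leq_add (leq_b1 _) (cards2_le x y))) //.
Qed.

Lemma missing_face_edge X r x y : is_complex X -> 2 < #|r| ->
  (forall z, z \in r -> r :\ z \in X) -> x \in r -> y \in r -> [set x; y] \in X.
Proof.
move=> cX cr H xr yr.
have [z zr] : exists2 z, z \in r & z \notin [set x; y].
  by apply: exists_notin; exact: leq_ltn_trans (cards2_le x y) cr.
rewrite !inE negb_or => /andP [zx zy]; apply: cX (H z zr) _.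
by rewrite subUset !sub1set !inE xr yr !(eq_sym _ z) zx zy.
Qed.

Lemma link_complex X v : is_complex X -> is_complex (link X [set v]).
Proof.
move=> cX a b; rewrite !in_complex_link // => /andP [va vaX] ba.
rewrite (contra _ va) /=; last exact: (subsetP ba).
exact: cX vaX (setUS _ ba).
Qed.

Lemma stacked_sphere_cases m X : stacked_sphere m X ->
  (exists2 S : {set T}, #|S| = m.+2 & X = simplex_boundary S) \/
  (exists r : {set T}, [/\ #|r| = m.+1, r \notin X & forall x, x \in r -> r :\ x \in X]).
Proof.
elim/stacked_sphere_ind => [S cS|{}X s v stX _ sX cs vX].
  by left; exists S.
have cX := stacked_sphere_complex stX.
have vs : v \notin s := fresh_notin cX vX sX.
right; exists s; split=> //; first by rewrite starring_face0 // eqxx andbF.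
move=> x xs; rewrite starring_face0; last by rewrite !inE (negbTE vs) andbF.
rewrite (cX _ _ sX) ?subsetDl //=.
by apply: proper_neq; exact: properD1.
Qed.

(** Subsets through [w] come from the link of [w]; only [r] itself is in doubt. For [u] in [r], all
    proper subsets of [r :\ u] lie in the link of [u], and since [r :\ u] has size [m >= 3],
    [no_small_missing_face] puts it there too. *)
Lemma missing_face_of_link m X w r : 2 < m -> locally_stacked m X -> [set w] \in X ->
  #|r| = m.+1 -> r \notin link X [set w] ->
  (forall x, x \in r -> r :\ x \in link X [set w]) ->
  [/\ #|w |: r| = m.+2, w |: r \notin X & forall x, x \in w |: r -> (w |: r) :\ x \in X].
Proof.
move=> m2 [cX lX] wX cr rN H.
have wr : w \notin r.
  apply/negP => wr; have [x xr] : exists2 x, x \in r & x \notin [set w].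
    by apply: exists_notin; rewrite cards1 cr ltnS ltnW // ltnW.
  rewrite !inE => xw; move: (H x xr); rewrite in_complex_link // !inE.
  by rewrite wr eq_sym xw.
have rX : r \in X.
  have [u ur] : exists u, u \in r by apply/set0Pn; rewrite -card_gt0 cr.
  have uX : [set u] \in X.
    have [y yr] : exists2 y, y \in r & y \notin [set u].
      by apply: exists_notin; rewrite cards1 cr ltnS ltnW // ltnW.
    rewrite inE => yu; move: (H y yr); rewrite in_link => /and3P [ryX _ _].
    by apply: cX ryX _; rewrite sub1set !inE ur eq_sym yu.
  suff : r :\ u \in link X [set u].
    by rewrite in_complex_link // setD1K // => /andP [].
  apply: (no_small_missing_face (lX u uX)); first by rewrite (card_setD1 ur cr) m2 leqnn.
  move=> x /setD1P [xu xr]; rewrite in_complex_link //.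
  move: (H x xr); rewrite in_link => /and3P [rxX _ _].
  have -> : u |: r :\ u :\ x = r :\ x.
    by apply/setP => z; rewrite !inE; case: eqVneq => [->|] //=; rewrite eq_sym xu ur.
  by rewrite rxX !inE eqxx andbF.
split; first exact: card_setU1.
  by move: rN; rewrite in_complex_link // wr.
move=> x; rewrite !inE => /orP [/eqP ->|xr]; first by rewrite setU1K.
have xw : x != w by apply: contraNneq wr => <-.
move: (H x xr); rewrite in_complex_link // => /andP [_].
by have -> : (w |: r) :\ x = w |: (r :\ x) by set_solve.
Qed.

Lemma missing_face_separates m X r : 2 < m -> locally_stacked m X -> Z2_acyclic X ->
  #|r| = m.+2 -> r \notin X -> (forall x, x \in r -> r :\ x \in X) ->
  exists g, edge_constant_off X r g /\
    forall u (c : bool), u \in r -> exists x, [/\ x \notin r, g x = c & [set u; x] \in X].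
Proof.
move=> m2 [cX lX] aX cr rN H.
have m0 : 0 < m by exact: ltn_trans m2.
have other (A : {set T}) : #|A| < m.+2 -> exists2 x, x \in r & x \notin A.
  by rewrite -cr => /exists_notin.
have pairX x y : x \in r -> y \in r -> [set x; y] \in X.
  by apply: missing_face_edge; rewrite // cr; exact: leqW (leqW m2).
have vertX x : x \in r -> [set x] \in X.
  by move=> xr; move: (pairX x x xr xr); rewrite setUid.
have sides u : u \in r -> exists t, [/\ edge_constant_off (link X [set u]) (r :\ u) t,
    (forall t', edge_constant_off (link X [set u]) (r :\ u) t' -> exists c0 c1 : bool,
       forall x, [set x] \in link X [set u] -> x \notin (r :\ u) ->
         t' x = if t x then c1 else c0) &
    (forall x (c : bool), x \in r :\ u ->
       exists y, [/\ y \notin r :\ u, y |: (r :\ u :\ x) \in link X [set u] & t y = c])].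
  move=> ur; apply: missing_facet_sides (lX u (vertX u ur)) _ _ _.
  - exact: ltnW.
  - exact: card_setD1.
  - by rewrite in_complex_link // setD1K // (negbTE rN) andbF.
  - move=> x /setD1P [xu xr]; rewrite in_complex_link // !inE eqxx andbF /=.
    have -> : u |: r :\ u :\ x = r :\ x; last exact: H.
    by apply/setP => z; rewrite !inE; case: (eqVneq z u) => [->|] //=; rewrite eq_sym xu ur.
have /boolp.choice [s Hs] : forall u, exists t, u \in r ->
    edge_constant_off (link X [set u]) (r :\ u) t /\
    forall x (c : bool), x \in r -> x != u ->
      exists y, [/\ y \notin r, y |: (r :\ x) \in X & t y = c].
  move=> u; have [ur|] := boolP (u \in r); last by exists (fun=> false).
  have [t [t1 _ t3]] := sides u ur; exists t => _; split=> // x c xr xu.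
  have [|y [yr]] := t3 x c; first by rewrite !inE xu.
  rewrite in_complex_link // !inE negb_or => /andP [/andP [uy _] yX] ty.
  exists y; split=> //; first by move: yr; rewrite !inE eq_sym uy.
  move: yX; have -> // : u |: (y |: r :\ u :\ x) = y |: r :\ x.
  apply/setP => z; rewrite !inE; case: (eqVneq z u) => [->|] //=.
  by rewrite (eq_sym u x) xu ur orbT.
have s1 u x y : u \in r -> x \notin r -> y \notin r -> [set u; x; y] \in X -> s u x = s u y.
  move=> ur xr yr uxyX; have [su _] := Hs u ur; apply: su.
  - rewrite in_complex_link // !inE setUA uxyX andbT negb_or.
    by apply/andP; split; [apply: contraNneq xr => <-|apply: contraNneq yr => <-].
  - by rewrite !inE (negbTE xr) andbF.
  - by rewrite !inE (negbTE yr) andbF.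
have s3 u x (c : bool) : u \in r -> x \in r -> x != u ->
    exists y, [/\ y \notin r, y |: (r :\ x) \in X & s u y = c].
  by move=> ur; have [_] := Hs u ur; exact.
(* In the link of the edge, [r :\ u :\ u'] is a missing facet with sides [q]. Both [s u] and [s u']
   are constant on each side of [q] and take both values, so each equals [q] up to a sign. *)
have compare u u' : exists e : bool, u \in r -> u' \in r -> forall x, x \notin r ->
    [set u; u'; x] \in X -> s u x = s u' x (+) e.
  have [ur|] := boolP (u \in r); last by exists false.
  have [u'r|] := boolP (u' \in r); last by exists false.
  have [->|uu'] := eqVneq u u'; first by exists false => *; rewrite addbF.
  have in2 b : (b \in link (link X [set u]) [set u']) =
      [&& u' \notin b, u \notin u' |: b & u |: (u' |: b) \in X].
    by rewrite in_complex_link; [rewrite in_complex_link|exact: link_complex].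
  have u'r' : u' \in r :\ u by rewrite !inE eq_sym uu'.
  have cr' : #|r :\ u :\ u'| = m by exact: card_setD1 u'r' (card_setD1 ur cr).
  have stL : stacked_sphere m.-1 (link (link X [set u]) [set u']).
    apply: link_stacked.
      by rewrite prednK //; exact: lX (vertX u ur).
    by rewrite in_complex_link // !inE uu' pairX.
  have [||||q [_ q2 _]] := @missing_facet_sides _ _ _ (r :\ u :\ u') _ stL.
  - by rewrite -ltnS prednK.
  - by rewrite cr' prednK.
  - by rewrite in2 !setD1K // (negbTE rN) !andbF.
  - move=> x /setD1P [xu' /setD1P [xu xr]]; rewrite in2.
    have -> : u' |: r :\ u :\ u' :\ x = r :\ u :\ x.
      apply/setP => z; rewrite !inE; case: (eqVneq z u') => [->|] //=.
      by rewrite !(eq_sym u') xu' uu' u'r.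
    have -> : u |: r :\ u :\ x = r :\ x; last by rewrite H // !inE !eqxx ?andbF.
    by apply/setP => z; rewrite !inE; case: (eqVneq z u) => [->|] //=; rewrite eq_sym xu ur.
  (* Facets over [r :\ x] contain [u] and [u'], so their outer vertices show both values of each
     labelling inside the link of the edge. *)
  have [x xr] : exists2 x, x \in r & x \notin [set u; u'].
    by apply: other; exact: leq_ltn_trans (cards2_le u u') (leqW (leqW m2)).
  rewrite !inE negb_or => /andP [xu xu'].
  have in_ridge y : y |: (r :\ x) \in X -> [set u; u'; y] \in X.
    move=> yX; apply: cX yX _; rewrite !subUset !sub1set !inE ur u'r eqxx.
    by rewrite !(eq_sym _ x) xu xu' !orbT.
  have vert2 y : y \notin r -> [set u; u'; y] \in X ->
      [set y] \in link (link X [set u]) [set u'] /\ y \notin r :\ u :\ u'.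
    move=> yr yX; rewrite in2 !inE !setUA yX (negbTE yr) !andbF negb_or uu' andbT.
    by split=> //; apply/andP; split; apply: contraNneq yr => <-.
  have affine p : p = s u \/ p = s u' ->
      exists c : bool, forall y, y \notin r -> [set u; u'; y] \in X -> p y = q y (+) c.
    move=> Ep; have pE : exists c0 c1 : bool,
        forall y, y \notin r -> [set u; u'; y] \in X -> p y = if q y then c1 else c0.
      have [|c0 [c1 Hc]] := q2 p; last first.
        by exists c0, c1 => y yr yX; have [] := vert2 y yr yX; exact: Hc.
      move=> y z; rewrite in2 => /and3P [u'yz uyz yzX].
      have Nr t : t \in [set y; z] -> t \notin r :\ u :\ u' -> t \notin r.
        move=> tyz; rewrite !inE; case: eqVneq => [E|_] /=.
          by move: u'yz; rewrite -E tyz.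
        case: eqVneq => [E|_] //=.
        by move: uyz; rewrite -E in_setU1 tyz orbT.
      move=> /Nr yr /Nr zr.
      have {}yr : y \notin r by apply: yr; rewrite !inE eqxx.
      have {}zr : z \notin r by apply: zr; rewrite !inE eqxx orbT.
      case: Ep => ->; apply: s1 => //; apply: cX yzX _.
        by rewrite !subUset !sub1set !inE !eqxx !orbT.
      by rewrite !subUset !sub1set !inE !eqxx !orbT.
    have [c0 [c1 Hc]] := pE.
    have Hp (c : bool) : exists2 y, y \notin r /\ [set u; u'; y] \in X & p y = c.
      case: Ep => ->.
        by have [y [yr /in_ridge yX py]] := s3 u x c ur xr xu; exists y.
      by have [y [yr /in_ridge yX py]] := s3 u' x c u'r xr xu'; exists y.
    have [y [yr yX] py] := Hp true; have [z [zr zX] pz] := Hp false.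
    exists c0 => t tr tX; rewrite Hc //.
    move: py pz; rewrite !Hc //; clear.
    by case: (q t); case: (q y); case: (q z); case: c0 => //; case: c1.
  have [c Ec] := affine (s u) (or_introl erefl).
  have [c' Ec'] := affine (s u') (or_intror erefl).
  exists (c (+) c') => _ _ y yr yX; rewrite Ec // Ec' //.
  by rewrite addbCA -!addbA addbb addbF addbC.
have [e He] : exists e : T -> T -> bool, forall u u', u \in r -> u' \in r ->
    forall x, x \notin r -> [set u; u'; x] \in X -> s u x = s u' x (+) e u u'.
  have /boolp.choice [e He] : forall p : T * T, exists e : bool, p.1 \in r -> p.2 \in r ->
      forall x, x \notin r -> [set p.1; p.2; x] \in X -> s p.1 x = s p.2 x (+) e.
    by move=> p; exact: compare.
  by exists (fun u u' => e (u, u')) => u u'; exact: He (u, u').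
have e_cocycle u u' u'' : u \in r -> u' \in r -> u'' \in r -> e u u'' = e u u' (+) e u' u''.
  (* All three signs are read off at one vertex [y], the outer vertex of a facet over [r :\ x] for a
     fourth vertex [x] of [r]. *)
  move=> ur u'r u''r; have [|x xr] := other [set u; u'; u''].
    exact: leq_ltn_trans (cards3_le u u' u'') (leqW (m2 : 3 < m.+1)).
  rewrite !inE !negb_or -andbA => /and3P [xu xu' xu''].
  have [y [yr yX _]] := s3 u x true ur xr xu.
  have in_ridge z t : z \in r -> t \in r -> x != z -> x != t -> [set z; t; y] \in X.
    move=> zr tr xz xt; apply: cX yX _; rewrite !subUset !sub1set !inE zr tr eqxx.
    by rewrite !(eq_sym _ x) xz xt !orbT.
  have E1 := He u u' ur u'r y yr (in_ridge _ _ ur u'r xu xu').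
  have E2 := He u' u'' u'r u''r y yr (in_ridge _ _ u'r u''r xu' xu'').
  have := He u u'' ur u''r y yr (in_ridge _ _ ur u''r xu xu'').
  rewrite E1 E2; case: (s u'' y); case: (e u u''); case: (e u u'); by case: (e u' u'').
have [u0 u0r] : exists u0, u0 \in r by apply/set0Pn; rewrite -card_gt0 cr.
pose s' u x := s u x (+) e u u0.
have s'E u u' x : u \in r -> u' \in r -> x \notin r -> [set u; u'; x] \in X ->
    s' u x = s' u' x.
  move=> ur u'r xr uu'xX; rewrite /s' (He u u') // (e_cocycle u u' u0) //.
  by rewrite -!addbA; congr (_ (+) _); rewrite addbA addbb.
(* Edges leaving [r] carry the side of their outer end. Triangles with two vertices in [r] close by
   agreement of the normalized labels, those with one by constancy of its labelling on the opposite
   edge. *)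
pose c x y := if x \in r then if y \in r then false else s' x y
              else if y \in r then s' y x else false.
have [|f Hf] := aX c.
  move=> x y z xyzX; rewrite /c.
  have xr := boolP (x \in r); have yr := boolP (y \in r); have zr := boolP (z \in r).
  have yzxX : [set y; z; x] \in X by rewrite setUC setUA.
  have xzyX : [set x; z; y] \in X by rewrite setUAC.
  case: xr => xr; case: yr => yr; case: zr => zr //=; rewrite ?addbF.
  - by apply/esym/s'E.
  - by rewrite (s'E x z) ?addbb.
  - by rewrite /s' (s1 x y z).
  - exact: s'E.
  - by rewrite /s' (s1 y x z) ?addbb // (setUC [set y]).
  - by rewrite /s' (s1 z y x) // -setUA setUC (setUC [set y]).
have fr u : u \in r -> f u = f u0.
  move=> ur; move: (Hf u u0 (pairX _ _ ur u0r)); rewrite /c ur u0r.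
  by case: (f u); case: (f u0).
exists f; split.
  move=> x y xyX xr yr; move: (Hf x y xyX); rewrite /c (negbTE xr) (negbTE yr).
  by case: (f x); case: (f y).
move=> u d ur; have [x xr xu] : exists2 x, x \in r & x \notin [set u].
  by apply: other; rewrite cards1.
rewrite inE in xu.
(* The requested value is corrected by the normalization [e u u0] and by the constant value of [f]
   on [r], because [f y = f u0 (+) s' u y]. *)
have [y [yr yX sy]] := s3 u x (d (+) f u0 (+) e u u0) ur xr xu.
have uyX : [set u; y] \in X.
  by apply: cX yX _; rewrite subUset !sub1set !inE eqxx ur (eq_sym u x) xu orbT.
exists y; split => //; move: (Hf u y uyX); rewrite /c ur (negbTE yr) /s' sy (fr u) //.
clear; by case: d; case: (f u0); case: (e u u0); case: (f y).
Qed.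

End LocallyStacked.

(** * Finding and removing a vertex whose link is the boundary of a simplex *)

Section Reduction.
Variable T : finType.
Implicit Types (X Y : {set {set T}}) (a b r S C : {set T}) (u v w x y z : T).

(* Induction on the size of the side [C]: a vertex of [C] whose link is not the
   boundary of a simplex gives rise to a missing face with a smaller side. *)
Lemma exists_simplex_link_in_side m X r C : 2 < m -> locally_stacked m X ->
  Z2_acyclic X -> #|r| = m.+2 ->
  (forall x y, x \in r -> y \in r -> [set x; y] \in X) ->
  (exists w, w \in C) -> (forall x, x \in C -> [set x] \in X /\ x \notin r) ->
  (forall x y, x \in C -> [set x; y] \in X -> y \in C :|: r) ->
  exists w S, [/\ [set w] \in X, #|S| = m.+2 & link X [set w] = simplex_boundary S].
Proof.
move=> m2 lX aX; have [n] := ubnP #|C|.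
elim: n => // n IH in r C *; rewrite ltnS => leCn cr clique [w wC] vertC nbrC.
have [wX wr] := vertC w wC.
have [[S cS E]|[s [cs sN Hs]]] := stacked_sphere_cases (lX.2 w wX).
  by exists w, S.
have [cr' r'N Hr'] := missing_face_of_link m2 lX wX cs sN Hs.
have [g [g1 g2]] := missing_face_separates m2 lX aX cr' r'N Hr'.
set r' := w |: s in cr' r'N Hr' g1 g2.
have clique' x y : x \in r' -> y \in r' -> [set x; y] \in X.
  by apply: missing_face_edge Hr'; [exact: lX.1|rewrite cr'; exact: leqW (leqW m2)].
have wr' : w \in r' by rewrite setU11.
have [y0 y0r y0r'] : exists2 y, y \in r & y \notin r'.
  have : ~~ (r \subset r').
    apply: contra wr => rr'; rewrite (_ : r = r') //.
    by apply: eq_of_sub_card rr' _; rewrite cr cr'.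
  by case/subsetPn => y; exists y.
(* What remains of the clique [r] outside [r'] lies on the side of [y0]. The opposite side avoids
   [r], so within [C] it is bounded by [r'] alone, and it no longer contains [w]. *)
pose C' := [set z in C | (z \notin r') && (g z != g y0)].
have rg y : y \in r -> y \notin r' -> g y = g y0 by move=> yr yr'; apply: g1 => //; exact: clique.
apply: (IH r' C') => //.
- apply: leq_trans leCn; apply: proper_card; apply/properP; split.
    by apply/subsetP => z; rewrite !inE => /and3P [].
  by exists w => //; rewrite inE wr' andbF.
- have [a [ar' ga waX]] := g2 w (~~ g y0) wr'.
  have gN : g a != g y0 by rewrite ga; case: (g y0).
  exists a; rewrite inE ar' gN !andbT.
  have := nbrC w a wC waX; rewrite inE => /orP [//|ar].
  by move: gN; rewrite (rg a ar ar') eqxx.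
- by move=> x; rewrite inE => /and3P [xC xr' _]; split => //; have [] := vertC x xC.
- move=> x y; rewrite inE => /and3P [xC xr' gx] xyX; rewrite in_setU.
  have [yr'|yr'] := boolP (y \in r'); first by rewrite orbT.
  have gy : g y != g y0 by rewrite -(g1 x y xyX).
  rewrite orbF inE yr' gy !andbT; have := nbrC x y xC xyX.
  by rewrite inE => /orP [//|yr]; move: gy; rewrite (rg y) ?eqxx.
Qed.

Lemma exists_simplex_link m X : 2 < m -> locally_stacked m X -> Z2_acyclic X ->
  (exists v, [set v] \in X) ->
  exists w S, [/\ [set w] \in X, #|S| = m.+2 & link X [set w] = simplex_boundary S].
Proof.
move=> m2 lX aX [v vX].
have [[S cS E]|[s [cs sN Hs]]] := stacked_sphere_cases (lX.2 v vX); first by exists v, S.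
have [cr rN Hr] := missing_face_of_link m2 lX vX cs sN Hs.
have [g [g1 g2]] := missing_face_separates m2 lX aX cr rN Hr.
set r := v |: s in cr rN Hr g1 g2.
have clique x y : x \in r -> y \in r -> [set x; y] \in X.
  by apply: missing_face_edge Hr; [exact: lX.1|rewrite cr; exact: leqW (leqW m2)].
apply: (@exists_simplex_link_in_side m X r [set z | [&& [set z] \in X, z \notin r & g z]]) => //.
- have [a [ar ga vaX]] := g2 v true (setU11 _ _).
  exists a; rewrite inE ar ga !andbT; apply: lX.1 vaX _.
  by rewrite sub1set !inE eqxx orbT.
- by move=> x; rewrite inE => /and3P [].
- move=> x y; rewrite inE => /and3P [xX xr gx] xyX; rewrite in_setU inE.
  have [yr|yr] := boolP (y \in r); first by rewrite orbT.
  rewrite orbF -(g1 x y xyX) // gx ?yr !andbT; apply: lX.1 xyX _.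
  by rewrite sub1set !inE eqxx orbT.
Qed.

(** The link of each vertex of [w |: S] contains the boundary of a simplex of full dimension, hence
    equals it. So no edge leaves [w |: S], and connectedness excludes further vertices. *)
Lemma boundary_of_filled_link m X w S : 2 < m -> locally_stacked m X -> edge_connected X ->
  [set w] \in X -> #|S| = m.+2 -> link X [set w] = simplex_boundary S -> S \in X ->
  X = simplex_boundary (w |: S).
Proof.
move=> m2 [cX lX] conX wX cS E SX.
have Ew b : (w \notin b) && (w |: b \in X) = (b \proper S).
  by rewrite -in_boundary -E in_complex_link.
have wS : w \notin S.
  apply/negP => wS; have [x xS] : exists2 x, x \in S & x \notin [set w].
    by apply: exists_notin; rewrite cards1 cS.
  by rewrite inE => xw; have := Ew (S :\ x); rewrite properD1 // !inE wS eq_sym xw.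
have sub : simplex_boundary (w |: S) \subset X.
  apply/subsetP => b; rewrite in_boundary; have [wb|wb] := boolP (w \in b).
    rewrite -{1}(setD1K wb) proper_add1_self ?setU11 ?setU1K // ?inE ?eqxx //.
    by rewrite -Ew setD1K // => /andP [].
  move/proper_sub => bwS; apply: cX SX _; apply/subsetP => z zb.
  move/subsetP/(_ z zb): bwS; rewrite !inE => /orP [/eqP Ez|//].
  by move: wb; rewrite -Ez zb.
have cwS : #|w |: S| = m.+3 by exact: card_setU1.
have vertX x : x \in w |: S -> [set x] \in X.
  move=> xS; apply: (subsetP sub); rewrite in_boundary proper_set_one // cwS //.
have link_x x : x \in w |: S -> link X [set x] = simplex_boundary ((w |: S) :\ x).
  move=> xS; apply: boundary_sub_eq (lX x (vertX x xS)) _ _.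
  - exact: ltn_trans m2.
  - exact: card_setD1.
  - apply/subsetP => b; rewrite in_boundary => bwS.
    have xb : x \notin b.
      by apply/negP => /(subsetP (proper_sub bwS)); rewrite !inE eqxx.
    rewrite in_complex_link // xb; apply: (subsetP sub).
    by rewrite in_boundary proper_add1_self.
have nbr x y : x \in w |: S -> [set x; y] \in X -> y \in w |: S.
  move=> xS xyX; have [<-//|xy] := eqVneq x y.
  have : [set y] \in link X [set x] by rewrite in_complex_link // inE xy.
  rewrite link_x // in_boundary => /proper_sub; rewrite sub1set => yS.
  by move: yS; rewrite in_setD1 => /andP [].
have vert y : [set y] \in X -> y \in w |: S.
  move=> yX; have <- : (w \in w |: S) = (y \in w |: S); last exact: setU11.
  apply: (conX (fun z => z \in w |: S)) => // x z xzX.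
  by apply/idP/idP => [xS|zS]; [exact: nbr xzX|apply: (nbr z) => //; rewrite setUC].
apply/eqP; rewrite eqEsubset sub andbT; apply/subsetP => b bX.
rewrite in_boundary properEneq; apply/andP; split; last first.
  by apply/subsetP => y yb; apply: vert; apply: cX bX _; rewrite sub1set.
apply: contraTneq bX => ->; apply: contraT; rewrite negbK => wSX.
by have := Ew S; rewrite wS wSX properxx.
Qed.

(** Sending [w] to a vertex of [S] is a simplicial map [p] onto the new complex, because [S] is now
    a face. Cocycles and edge-constant functions pull back along [p], and edges of the new complex
    are edges of [X] fixed by [p]. *)
Lemma unstarring_inherits m X w S : 2 < m -> locally_stacked m X -> Z2_acyclic X ->
  edge_connected X -> #|S| = m.+2 -> link X [set w] = simplex_boundary S -> S \notin X ->
  [/\ locally_stacked m (unstarring X w S), Z2_acyclic (unstarring X w S),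
      edge_connected (unstarring X w S),
      forall v, ([set v] \in unstarring X w S) = ([set v] \in X) && (v != w) &
      X = starring (unstarring X w S) S w].
Proof.
move=> m2 [cX lX] aX conX cS E SX.
have Ew0 b : (w \notin b) && (w |: b \in X) = (b \proper S).
  by rewrite -in_boundary -E in_complex_link.
have Ew b : w \notin b -> (w |: b \in X) = (b \proper S) by move=> wb; rewrite -Ew0 wb.
have wS : w \notin S.
  apply/negP => wS; have [x xS] : exists2 x, x \in S & x \notin [set w].
    by apply: exists_notin; rewrite cards1 cS.
  by rewrite inE => xw; have := Ew0 (S :\ x); rewrite properD1 // !inE wS eq_sym xw.
have notS b : #|b| < m.+2 -> b != S by apply: contraTneq => ->; rewrite cS ltnn.
have subS_X b : b \proper S -> b \in X.
  by rewrite -Ew0 => /andP [_ bX]; apply: cX bX _; exact: subsetU1.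
have c2 : 1 < #|S| by rewrite cS.
have cY : is_complex (unstarring X w S).
  move=> b c; rewrite !in_unstarring => /orP [/eqP ->|/andP [bX wb]] cb.
    have [//|nc] := eqVneq c S; rewrite subS_X ?properEneq ?nc //=.
    by apply: contra wS; exact: (subsetP cb).
  by rewrite (cX _ _ bX cb) /= (contra _ wb) ?orbT //; exact: (subsetP cb).
have subS_Y b : b \subset S -> b \in unstarring X w S.
  by apply: cY; rewrite in_unstarring eqxx.
have Y_X b : #|b| < m.+2 -> b \in unstarring X w S -> b \in X /\ w \notin b.
  by move=> cb; rewrite in_unstarring (negbTE (notS b cb)) => /andP.
have [y0 y0S] : exists y, y \in S by apply/set0Pn; rewrite -card_gt0 cS.
pose p x := if x == w then y0 else x.
have pN x : x != w -> p x = x by rewrite /p => /negbTE ->.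
have p3 x y z : [set x; y; z] \in X -> [set p x; p y; p z] \in unstarring X w S.
  move=> xyzX; have [wxyz|wxyz] := boolP (w \in [set x; y; z]).
    apply: subS_Y; have : [set x; y; z] :\ w \proper S.
      by rewrite -Ew ?setD1K // !inE eqxx.
    move=> /proper_sub /subsetP sub.
    have pS u : u \in [set x; y; z] -> p u \in S.
      move=> uxyz; rewrite /p; case: eqVneq => // uw; apply: sub.
      by rewrite in_setD1 uw.
    by rewrite !subUset !sub1set !pS // !inE eqxx ?orbT.
  have /and3P [xw yw zw] : [&& x != w, y != w & z != w].
    by move: wxyz; rewrite !inE !negb_or !(eq_sym w) -andbA.
  by rewrite !pN // in_unstarring xyzX wxyz orbT.
have p2 x y : [set x; y] \in X -> [set p x; p y] \in unstarring X w S.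
  move=> xyX; have := p3 x y y; rewrite -!setUA !setUid; exact.
have edgeY x y : [set x; y] \in unstarring X w S -> [/\ [set x; y] \in X, p x = x & p y = y].
  move=> xyY; have [|xyX] := Y_X _ _ xyY.
    exact: leq_ltn_trans (cards2_le x y) (leqW (leqW m2)).
  by rewrite !inE negb_or !(eq_sym w) => /andP [xw yw]; rewrite !pN.
have vertY v : ([set v] \in unstarring X w S) = ([set v] \in X) && (v != w).
  by rewrite in_unstarring (negbTE (notS _ _)) ?cards1 // inE eq_sym.
split=> //.
- split=> // v; rewrite vertY => /andP [vX vw].
  have stv := lX v vX; have [vS|vS] := boolP (v \in S); last first.
    suff -> : link (unstarring X w S) [set v] = link X [set v] by [].
    apply/setP => b; rewrite !in_complex_link // in_unstarring.
    have [//|vb] /= := boolP (v \in b).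
    have -> /= : (v |: b == S) = false by apply: contraNF vS => /eqP <-; rewrite setU11.
    apply: andb_idr => vbX; apply: contra vS => wb; rewrite -proper_set_one // -Ew.
      by apply: cX vbX _; rewrite subUset !sub1set wb setU11.
    by rewrite inE eq_sym.
  have -> : link (unstarring X w S) [set v] = unstarring (link X [set v]) w (S :\ v).
    apply/setP => b; rewrite in_unstarring !in_complex_link // in_unstarring.
    have [vb|vb] /= := boolP (v \in b).
      by rewrite orbF; apply/esym; apply: contraTF vb => /eqP ->; rewrite !inE eqxx.
    rewrite !inE negb_or (eq_sym w) vw /=; congr (_ || _).
    by apply/eqP/eqP => [<-|->]; rewrite ?setU1K ?setD1K.
  apply: unstarring_stacked => //.
  - exact: ltnW.
  - exact: card_setD1.
  - by rewrite !inE (negbTE wS) andbF.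
  - by rewrite in_complex_link // setD1K // (negbTE SX) andbF.
  - move=> b wb; rewrite in_complex_link // in_setU1 (negbTE vw) /=.
    have [vb|vb] /= := boolP (v \in b).
      by apply/esym/negP => /proper_sub/subsetP/(_ v vb); rewrite !inE eqxx.
    by rewrite setUCA Ew ?proper_add1_self // !inE negb_or eq_sym vw.
- move=> c Hc; have [|f Hf] := aX (fun x y => c (p x) (p y)).
    by move=> x y z /p3; exact: Hc.
  by exists f => x y /edgeY [/Hf <-] -> ->.
- move=> f Hf x y; rewrite !vertY => /andP [xX xw] /andP [yX yw].
  rewrite -{1}(pN x xw) -(pN y yw).
  by apply: (conX (f \o p)) => // u v /p2 /Hf.
- apply/setP => b; rewrite in_starring in_unstarring; case: ifP => wb.
    by rewrite -{1}(setD1K wb) Ew // !inE eqxx.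
  by have [->|_] /= := eqVneq b S; rewrite ?(negbTE SX) ?wb ?andbT.
Qed.

Lemma locally_stacked_stacked m X : 2 < m -> locally_stacked m X -> Z2_acyclic X ->
  edge_connected X -> (exists v, [set v] \in X) -> stacked_sphere m.+1 X.
Proof.
move=> m2; have [n] := ubnP #|[set v | [set v] \in X]|.
elim: n => // n IH in X *; rewrite ltnS => leXn lX aX conX vX.
have [w [S [wX cS E]]] := exists_simplex_link m2 lX aX vX.
have wS : w \notin S.
  apply/negP => wS; have : [set w] \in link X [set w].
    by rewrite E in_boundary proper_set_one // cS.
  by rewrite in_link inE eqxx andbF.
have [SX|SX] := boolP (S \in X).
  rewrite (boundary_of_filled_link m2 lX conX wX cS E SX).
  by apply: stacked_sphere_boundary; exact: card_setU1.
have [lY aY conY vertY EX] := unstarring_inherits m2 lX aX conX cS E SX.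
rewrite EX; apply: stacked_sphere_starring => //.
- apply: IH => //.
    apply: leq_trans leXn; apply: proper_card; apply/properP; split.
      by apply/subsetP => v; rewrite in_set vertY => /andP [vvX _]; rewrite in_set.
    by exists w; rewrite in_set // vertY eqxx andbF.
  have [y yS] : exists y, y \in S by apply/set0Pn; rewrite -card_gt0 cS.
  exists y; apply: lY.1 (_ : S \in _) _; first by rewrite in_unstarring eqxx.
  by rewrite sub1set.
- by rewrite in_unstarring eqxx.
- by rewrite vertY eqxx andbF.
Qed.

End Reduction.

(** * Closed walks *)

Section Walks.
Variable T : finType.
Implicit Types (X Y : {set {set T}}) (w : nat -> T).

(* Contiguous closed walks [w], [w'] of length [N]: the four vertices of every
   square of the strip between them span a face. *)
Inductive contractible_walk X (N : nat) : (nat -> T) -> Prop :=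
| contractible_const w x : [set x] \in X -> (forall k, k <= N -> w k = x) ->
    contractible_walk X N w
| contractible_step w w' :
    (forall k, k < N -> [set w k; w k.+1] :|: [set w' k; w' k.+1] \in X) ->
    w' 0 = w' N -> contractible_walk X N w' -> contractible_walk X N w.

Lemma contractible_walk_mono X Y N w :
  (forall b : {set T}, #|b| <= 4 -> b \in X -> b \in Y) ->
  contractible_walk X N w -> contractible_walk Y N w.
Proof.
move=> XY; elim=> {w} [w x xX wx|w w' ww' w'N _ IH].
  by apply: contractible_const wx; apply: XY xX; rewrite cards1.
apply: contractible_step w'N IH => k kN; apply: XY (ww' k kN).
apply: leq_trans (leq_add (cards2_le (w k) (w k.+1)) (cards2_le (w' k) (w' k.+1))).
by rewrite -cardsUI leq_addr.
Qed.

Lemma stacked_sphere_contractible_walk d X N w : 3 < d -> stacked_sphere d X ->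
  0 < N -> (forall k, k < N -> [set w k; w k.+1] \in X) -> w 0 = w N ->
  contractible_walk X N w.
Proof.
move=> d4 stX N0; elim/stacked_sphere_ind: stX w => [S cS|{}X s v stX IH sX cs vX] w wX wN.
  have [x xS] : exists x, x \in S by apply/set0Pn; rewrite -card_gt0 cS.
  have d1 : 1 < #|S| by rewrite cS.
  apply: (@contractible_step _ _ _ (fun=> x)) => //; last first.
    by apply: (@contractible_const _ _ _ x) => //; rewrite in_boundary proper_set_one.
  move=> k kN; move: (wX k kN); rewrite !in_boundary setUid => /proper_sub wS.
  apply: proper_of_card; first by rewrite subUset wS sub1set.
  apply: leq_ltn_trans (_ : 3 < _); last by rewrite cS; exact: leqW (leqW d4).
  exact: cards3_le.
have cX := stacked_sphere_complex stX.
have vs : v \notin s := fresh_notin cX vX sX.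
have cX' : is_complex (starring X s v).
  by apply: stacked_sphere_complex; exact: stacked_sphere_starring stX sX cs vX.
have c2 : 2 < #|s| by rewrite cs; exact: leqW (ltnW d4).
have c1 : 1 < #|s| by exact: ltnW.
have [x xs] : exists x, x \in s by apply/set0Pn; rewrite -card_gt0 cs.
have xv : x != v by apply: contraNneq vs => <-.
(* Neighbours of [v] lie in [s], so steps of the walk at [v] become steps inside the old face [s].
   The square between old and new step spans at most [v] and two vertices of [s], which is a
   face. *)
pose w' k := if w k == v then x else w k.
have w'v k : w' k != v by rewrite /w'; have [_|] := eqVneq (w k) v.
have w'E k : w k != v -> w' k = w k by rewrite /w' => /negbTE ->.
have nbr y z : [set y; z] \in starring X s v -> y = v -> z != v -> z \in s.
  move=> yzX yv zv; move: yzX; rewrite yv starring_face1 ?proper_set_one //.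
  by rewrite inE eq_sym.
have w's k : k < N -> (w k == v) || (w k.+1 == v) -> w' k \in s /\ w' k.+1 \in s.
  move=> kN; have := wX k kN; rewrite /w'.
  case: (eqVneq (w k) v) => [E|nE]; case: (eqVneq (w k.+1) v) => [E'|nE'] //= H _.
    by split=> //; exact: nbr H E nE'.
  by split=> //; apply: nbr E' nE; rewrite setUC.
have w'X k : k < N -> [set w' k; w' k.+1] \in X.
  move=> kN; have [/w's [] // wks wk1s|] := boolP ((w k == v) || (w k.+1 == v)).
    by apply: cX sX _; rewrite subUset !sub1set wks.
  rewrite negb_or => /andP [wk wk1]; have := wX k kN.
  rewrite starring_old_edge // ?w'E //.
  by rewrite !inE negb_or !(eq_sym v) wk.
apply: (contractible_step (w' := w')) => [k kN||].
- have [vk|] := boolP ((w k == v) || (w k.+1 == v)); last first.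
    by rewrite negb_or => /andP [wk wk1]; rewrite !w'E // setUid wX.
  have [wks wk1s] := w's k kN vk.
  have : [set v; w' k; w' k.+1] \in starring X s v.
    rewrite -setUA starring_face1; last by rewrite !inE negb_or !(eq_sym v) !w'v.
    apply: proper_of_card; first by rewrite subUset !sub1set wks.
    exact: leq_ltn_trans (cards2_le _ _) _.
  move=> H; apply: cX' H _; have wE j : w j = v \/ w j = w' j.
    by rewrite /w'; case: eqVneq; [left|right].
  rewrite !subUset !sub1set; clear -wE.
  by case: (wE k) => ->; case: (wE k.+1) => ->; rewrite !inE !eqxx ?orbT.
- by rewrite /w' wN.
(* The contraction in [X] survives: it uses faces of at most 4 vertices, while the face lost has
   [d + 1 > 4]. *)
- apply: contractible_walk_mono (IH w' w'X _); last by rewrite /w' wN.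
  move=> b cb bX; rewrite starring_face0 ?bX /=; last exact: fresh_notin bX.
  by apply: contraTneq cb => ->; rewrite cs -ltnNge.
Qed.

Lemma normal_pseudomanifold_connected d X : normal_pseudomanifold d X -> complex_connected X.
Proof.
case=> _ [[cX [[a [aX _]] _]] [_ con]].
have X0 : set0 \in X by apply: cX aX _; exact: sub0set.
have E : link X set0 = X.
  by apply/setP => b; rewrite in_set set0U -setI_eq0 setI0 eqxx andbb.
by move: (con set0 X0); rewrite E cards0; exact.
Qed.

Lemma normal_pseudomanifold_edge_connected d X : normal_pseudomanifold d X ->
  edge_connected X.
Proof.
move=> nX f Hf x y xX yX.
have /connectP [p] := normal_pseudomanifold_connected nX xX yX.
elim: p x {xX} => [|z p IH] x /=; first by move=> _ ->.
by move=> /andP [xz pz] yE; rewrite (Hf x z) //; exact: IH.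
Qed.

Lemma stacked_sphere_in_K d X : 1 < d -> normal_pseudomanifold d X ->
  stacked_sphere d X -> in_K d X.
Proof.
move=> d1 nX stX; split=> //; split=> // v vX; apply: link_stacked => //.
by rewrite prednK // ltnW.
Qed.

Lemma in_K_acyclic_stacked d X : 3 < d -> in_K d X -> Z2_acyclic X -> stacked_sphere d X.
Proof.
move=> d4 [_ [nX lX]] aX; have [_ [[cX [[a [aX' ca]] _]] _]] := nX.
have d0 : 0 < d by exact: ltn_trans d4.
rewrite -(prednK d0); apply: locally_stacked_stacked => //.
- by rewrite -ltnS prednK.
- exact: normal_pseudomanifold_edge_connected nX.
- have [x xa] : exists x, x \in a by apply/set0Pn; rewrite -card_gt0 ca.
  by exists x; apply: cX aX' _; rewrite sub1set.
Qed.

End Walks.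

(** * Paths and homotopies in the geometric realization *)

From mathcomp Require Import all_algebra.
From mathcomp Require Import all_classical reals topology normedtype.
From mathcomp Require Import Rstruct Rstruct_topology.
From mathcomp Require Import lra.

Section Topology.
Import Order.TTheory GRing.Theory Num.Theory numFieldNormedType.Exports.
Local Open Scope classical_set_scope.
Local Open Scope ring_scope.
Local Notation R := Rdefinitions.R.

(** Composing with this retraction onto the unit interval extends paths and homotopies to the whole
    line or plane, which turns continuity on a subspace into plain continuity. *)
Definition clamp (x : R) : R := Num.max 0 (Num.min x 1).

Lemma clamp_I01 x : I01 (clamp x).
Proof.
by rewrite /I01 /clamp /= le_max lexx /= ge_max ler01 /= ge_min lexx orbT.
Qed.

Lemma clamp_id x : I01 x -> clamp x = x.
Proof.
by move=> /andP [x0 x1]; rewrite /clamp (min_idPl x1) (max_idPr x0).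
Qed.

Lemma clamp_le0 x : x <= 0 -> clamp x = 0.
Proof.
by move=> x0; apply/max_idPl; rewrite ge_min x0.
Qed.

Lemma clamp_ge1 x : 1 <= x -> clamp x = 1.
Proof.
by move=> x1; rewrite /clamp (min_idPr x1); apply/max_idPr.
Qed.

Lemma I01_0 : I01 0. Proof. by rewrite /I01 /= lexx ler01. Qed.
Lemma I01_1 : I01 1. Proof. by rewrite /I01 /= lexx ler01. Qed.

Section Continuity.
Variable U : topologicalType.
Implicit Types f g : U -> R.

Lemma ctsD f g : continuous f -> continuous g -> continuous (fun x => f x + g x).
Proof. by move=> cf cg x; exact: (@cvgD R R^o U _ _ f g _ _ (cf x) (cg x)). Qed.

Lemma ctsN f : continuous f -> continuous (fun x => - f x).
Proof. by move=> cf x; exact: (@cvgN R R^o U _ _ f _ (cf x)). Qed.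

Lemma ctsM f g : continuous f -> continuous g -> continuous (fun x => f x * g x).
Proof. by move=> cf cg x; exact: (@cvgM R U _ _ f g _ _ (cf x) (cg x)). Qed.

Lemma cts_cst (V : topologicalType) (c : V) : continuous (fun _ : U => c).
Proof. by move=> x; exact: cvg_cst. Qed.

Lemma cts_id : continuous (fun x : U => x).
Proof. by move=> x; exact: cvg_id. Qed.

Lemma cts_max f g : continuous f -> continuous g -> continuous (fun x => Num.max (f x) (g x)).
Proof. by move=> cf cg x; exact: (continuous_max (cf x) (cg x)). Qed.

Lemma cts_min f g : continuous f -> continuous g -> continuous (fun x => Num.min (f x) (g x)).
Proof. by move=> cf cg x; exact: (continuous_min (cf x) (cg x)). Qed.

Lemma cts_norm f : continuous f -> continuous (fun x => `|f x|).
Proof. by move=> cf x; apply: (continuous_comp (cf x)); exact: (@norm_continuous R R^o). Qed.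

Lemma cts_clamp f : continuous f -> continuous (fun x => clamp (f x)).
Proof.
move=> cf; apply: cts_max; first exact: cts_cst.
by apply: cts_min => //; exact: cts_cst.
Qed.

Lemma cts_comp (V W : topologicalType) (f : V -> W) (g : U -> V) :
  continuous f -> continuous g -> continuous (fun x => f (g x)).
Proof. by move=> cf cg x; exact: (continuous_comp (cg x) (cf (g x))). Qed.

Lemma cts_pair (V W : topologicalType) (f : U -> V) (g : U -> W) :
  continuous f -> continuous g -> continuous (fun x => (f x, g x)).
Proof. by move=> cf cg x; exact: (cvg_pair (cf x) (cg x)). Qed.

Lemma ctsvD n (f g : U -> 'rV[R]_n) :
  continuous f -> continuous g -> continuous (fun x => f x + g x).
Proof. by move=> cf cg x; exact: continuousD (cf x) (cg x). Qed.

Lemma ctsvN n (f : U -> 'rV[R]_n) : continuous f -> continuous (fun x => - f x).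
Proof. by move=> cf x; exact: continuousN (cf x). Qed.

Lemma ctsvZ n f (g : U -> 'rV[R]_n) :
  continuous f -> continuous g -> continuous (fun x => f x *: g x).
Proof. by move=> cf cg x; exact: continuousZ (cf x) (cg x). Qed.

Lemma ctsv_sum n (I : Type) (r : seq I) (F : I -> U -> 'rV[R]_n) :
  (forall i, continuous (F i)) -> continuous (fun x => \sum_(i <- r) F i x).
Proof.
move=> cF; elim: r => [|i r IH].
  have -> : (fun x => \sum_(i <- [::]) F i x) = fun=> 0.
    by apply/funext => x; rewrite big_nil.
  exact: cts_cst.
have -> : (fun x => \sum_(j <- i :: r) F j x) = fun x => F i x + \sum_(j <- r) F j x.
  by apply/funext => x; rewrite big_cons.
exact: ctsvD.
Qed.

Lemma within_comp (V W : topologicalType) (A : set V) (f : V -> W) (g : U -> V) :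
  {within A, continuous f} -> continuous g -> (forall x, A (g x)) ->
  continuous (fun x => f (g x)).
Proof.
move=> /subspace_continuousP cf cg Ag x B /= Bf.
have := cf _ (Ag x) B Bf; rewrite /within /= => nB.
have := cg x _ nB; rewrite !near_simpl /= => H.
by near=> y; have /= := near H y; apply.
Unshelve. all: by end_near. Qed.

End Continuity.

Lemma cts_mulr (c : R) : continuous ( *%R c).
Proof. by apply: (@ctsM R (fun=> c) (fun x => x)); [exact: cts_cst|exact: cts_id]. Qed.

Lemma cts_oppr : continuous (-%R : R -> R).
Proof. by apply: (@ctsN R (fun x => x)); exact: cts_id. Qed.

Lemma cts_fst : continuous (fun p : R * R => p.1).
Proof. by move=> x; exact: cvg_fst. Qed.

Lemma cts_snd : continuous (fun p : R * R => p.2).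
Proof. by move=> x; exact: cvg_snd. Qed.

Ltac cts :=
  repeat match goal with
  | H : continuous ?f |- continuous ?f => exact: H
  | |- continuous (fun _ => ?c) => exact: cts_cst
  | |- continuous (fun x => x) => exact: cts_id
  | |- continuous (fun p => p.1) => exact: cts_fst
  | |- continuous (fun p => p.2) => exact: cts_snd
  | |- continuous (fun x => clamp _) => apply: cts_clamp
  | |- continuous (fun x => Num.min _ _) => apply: cts_min
  | |- continuous (fun x => Num.max _ _) => apply: cts_max
  | |- continuous (fun x => `|_|) => apply: cts_norm
  | |- continuous (fun x => (_, _)) => apply: cts_pair
  | |- continuous (fun x => _ *: _) => apply: ctsvZ
  | |- continuous (fun x => _ * _) => apply: ctsM
  | |- continuous fst => exact: cts_fst
  | |- continuous snd => exact: cts_snd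
  | |- continuous -%R => exact: cts_oppr
  | |- continuous ( *%R _) => exact: cts_mulr
  | |- continuous (fun x => _ + _) => first [apply: ctsvD | apply: ctsD]
  | |- continuous (fun x => - _) => first [apply: ctsvN | apply: ctsN]
  | H : continuous ?f |- continuous (fun x => ?f _) => apply: (cts_comp H)
  end.

Lemma heine_cantor (U : pseudoMetricType R) n (K : set U) (f : U -> 'rV[R]_n) (e : R) :
  compact K -> continuous f -> 0 < e ->
  exists2 d : R, 0 < d & forall x y, K x -> ball x d y ->
    forall i, `|f x ord0 i - f y ord0 i| < e.
Proof.
move=> /compact_near_coveringP cK cf e0.
have e20 : 0 < e / 2 by rewrite divr_gt0.
pose P (d : R) (x : U) := forall y, ball x d y -> forall i, `|f x ord0 i - f y ord0 i| < e.
have : \forall d \near (0 : R)^'+, K `<=` P d.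
  apply: cK => x Kx.
  have /nbhs_ballP [r /= r0 Hr] : nbhs x (fun y => ball (f x) (e / 2) (f y)).
    by apply: cf; exact: nbhsx_ballx.
  have r20 : 0 < r / 2 by rewrite divr_gt0.
  have r2r : r / 2 <= r by lra.
  exists (ball x (r / 2), [set d | d < r / 2]) => /=.
    split; first exact: nbhsx_ballx.
    exact: nbhs_right_lt.
  move=> [x' d] /= [xx' dr] y x'y i.
  have [_ /(_ ord0 i) B1] : ball (f x) (e / 2) (f x').
    by apply: Hr; exact: le_ball r2r _ xx'.
  have [_ /(_ ord0 i) B2] : ball (f x) (e / 2) (f y).
    apply: Hr; rewrite (splitr r); apply: ball_triangle xx' _.
    by apply: le_ball x'y; exact: ltW.
  rewrite /ball /= in B1 B2; rewrite (splitr e) -(subrKA (f x ord0 i)).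
  by apply: (le_lt_trans (ler_normD _ _)); apply: ltrD => //; rewrite distrC.
move=> H; have [d [d0 Hd]] : exists d : R, 0 < d /\ K `<=` P d.
  near (0 : R)^'+ => d; exists d; split.
    by near: d; exact: nbhs_right_gt.
  by near: d.
by exists d => // x y /Hd; exact.
Unshelve. all: by end_near. Qed.

Lemma I01_compact : compact (I01 : set R).
Proof.
have -> : (I01 : set R) = `[0, 1]%classic.
  by apply/seteqP; split => x; rewrite /I01 /= in_itv.
exact: segment_compact.
Qed.

Lemma exists_inv_lt (d : R) : 0 < d -> exists2 N : nat, (0 < N)%N &
  forall M, (N <= M)%N -> M%:R^-1 < d.
Proof.
move=> d0; have [N HN] := ltr_add_invr d0; rewrite add0r in HN.
exists N.+1 => // M NM; apply: le_lt_trans HN.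
by rewrite lef_pV2 ?posrE ?ltr0n ?ler_nat // (leq_trans _ NM).
Qed.

(** * Simplices, labels and piecewise linear paths *)

Section Realization.
Variable n : nat.
Implicit Types (X : {set {set 'I_n}}) (a b : {set 'I_n}) (p q : 'rV[R]_n) (w : nat -> 'I_n).

(** The closed simplex on [a]: unlike the exact support used in [realization], this condition is
    convex. *)
Definition in_simplex a p : Prop :=
  [/\ forall i, 0 <= p ord0 i, \sum_(i < n) p ord0 i = 1 & forall i, i \notin a -> p ord0 i = 0].

Definition vertex (v : 'I_n) : 'rV[R]_n := delta_mx ord0 v.

Lemma vertexE v i : vertex v ord0 i = (i == v)%:R.
Proof. by rewrite mxE eqxx. Qed.

Lemma in_simplex_vertex a v : v \in a -> in_simplex a (vertex v).
Proof.
move=> va; split.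
- by move=> i; rewrite vertexE ler0n.
- rewrite (bigD1 v) //= vertexE eqxx big1 ?addr0 // => i iv.
  by rewrite vertexE (negbTE iv).
- by move=> i ia; rewrite vertexE; case: eqP => // E; rewrite E va in ia.
Qed.

Lemma in_simplex_segment a p q (t : R) : I01 t -> in_simplex a p -> in_simplex a q ->
  in_simplex a ((1 - t) *: p + t *: q).
Proof.
move=> /andP [t0 t1] [p0 p1 pa] [q0 q1 qa]; split.
- by move=> i; rewrite !mxE addr_ge0 // mulr_ge0 // subr_ge0.
- under eq_bigr do rewrite !mxE.
  by rewrite big_split /= -!big_distrr /= p1 q1 !mulr1 subrK.
- by move=> i ia; rewrite !mxE pa // qa // !mulr0 addr0.
Qed.

Lemma in_simplex_realization X a p : is_complex X -> a \in X -> in_simplex a p ->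
  realization X p.
Proof.
move=> cX aX [p0 p1 pa]; split=> //; split=> //.
apply: cX aX _; apply/fintype.subsetP => i; rewrite inE; apply: contraR => ia.
by rewrite pa.
Qed.

Lemma realization_in_simplex X p : realization X p ->
  exists a, [/\ a \in X, in_simplex a p & forall i, p ord0 i != 0 -> i \in a].
Proof.
case=> p0 [p1 pX]; exists [set i | p ord0 i != 0]%SET; split=> //.
  by split=> // i; rewrite inE negbK => /eqP.
by move=> i; rewrite inE.
Qed.

(* Points closer than [1 / n] to [p] have the vertex [lab p] in their support. *)
Lemma exists_label X : (exists p, realization X p) ->
  exists lab : 'rV[R]_n -> 'I_n, forall p, realization X p -> n%:R^-1 <= p ord0 (lab p).
Proof.
move=> [p1 Xp1].
suff /choice [lab Hlab] : forall p, exists i, realization X p -> n%:R^-1 <= p ord0 i by exists lab.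
have ex p : realization X p -> exists i, n%:R^-1 <= p ord0 i.
  case=> p0 [sp _]; apply: contrapT => /forallNP H.
  have lt i : p ord0 i < n%:R^-1 by rewrite ltNge; apply/negP/H.
  have [n0|n0] := posnP n.
    have : \sum_(i < n) p ord0 i = 0.
      by apply: big1 => i _; have := ltn_ord i; rewrite {2}n0.
    by rewrite sp => /eqP; rewrite oner_eq0.
  have : \sum_(i < n) p ord0 i < \sum_(i < n) (n%:R^-1 : R).
    apply: ltr_sum => //; apply/hasP; exists (Ordinal n0) => //.
  rewrite sp sumr_const card_ord -[_ *+ n]mulr_natl divff ?ltxx //.
  by rewrite pnatr_eq0 -lt0n.
have [i0 _] := ex p1 Xp1.
move=> p; have [/ex [i Hi]|NX] := pselect (realization X p); first by exists i.
by exists i0 => /NX.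
Qed.

Definition hat (x : R) : R := Num.max 0 (1 - `|x|).

(** Written as a sum of tent functions centred at the knots, the path is continuous without gluing;
    between two knots only their two tents are nonzero. *)
Definition walk_path (N : nat) w (s : R) : 'rV[R]_n :=
  \sum_(k < N.+1) hat (N%:R * s - k%:R) *: vertex (w k).

Lemma walk_path_cts N w : continuous (walk_path N w).
Proof. by apply: ctsv_sum => k; rewrite /hat; cts. Qed.

Lemma hat_far (x : R) : 1 <= `|x| -> hat x = 0.
Proof. by move=> x1; apply/max_idPl; rewrite subr_le0. Qed.

Lemma hat_near (x : R) : `|x| <= 1 -> hat x = 1 - `|x|.
Proof. by move=> x1; apply/max_idPr; rewrite subr_ge0. Qed.

Lemma walk_path_eval N w k (t s : R) : (k < N)%N -> I01 t -> N%:R * s = k%:R + t ->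
  walk_path N w s = (1 - t) *: vertex (w k) + t *: vertex (w k.+1).
Proof.
move=> kN /andP [t0 t1] E; rewrite /walk_path.
have kN' : (k < N.+1)%N by exact: ltnW.
rewrite (bigD1 (Ordinal kN')) //= (bigD1 (Ordinal (kN : (k.+1 < N.+1)%N))) /=; last first.
  by rewrite -val_eqE /= eqn_leq ltnn.
rewrite big1 ?addr0.
  rewrite E; congr (_ *: _ + _ *: _).
    have -> : k%:R + t - k%:R = t by lra.
    by rewrite hat_near ger0_norm.
  have -> : k%:R + t - k.+1%:R = t - 1 by rewrite -natr1; lra.
  have t10 : t - 1 <= 0 by rewrite subr_le0.
  by rewrite hat_near ler0_norm //; lra.
move=> j /andP [jk jk1]; rewrite hat_far ?scale0r // E.
have [lt|ge] := ltnP j k.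
  have : j.+1%:R <= k%:R :> R by rewrite ler_nat.
  rewrite -natr1 => jk'; rewrite ger0_norm; lra.
have lt : (k.+1 < j)%N.
  rewrite ltn_neqAle; apply/andP; split; first by rewrite eq_sym; exact: jk1.
  by rewrite ltn_neqAle ge andbT eq_sym; exact: jk.
have : k.+2%:R <= j%:R :> R by rewrite ler_nat.
rewrite -!natr1 => jk'; rewrite ler0_norm; lra.
Qed.

Lemma walk_path_vertex N w k (s : R) : (0 < N)%N -> (k <= N)%N -> N%:R * s = k%:R ->
  walk_path N w s = vertex (w k).
Proof.
move=> N0; rewrite leq_eqVlt => /orP [/eqP ->|kN] E.
  rewrite (@walk_path_eval _ _ N.-1 1); last first.
  - by rewrite natr1 prednK.
  - exact: I01_1.
  - by rewrite prednK.
  by rewrite subrr scale0r scale1r add0r prednK.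
rewrite (@walk_path_eval _ _ k 0) //; last by rewrite addr0.
  by rewrite subr0 scale0r scale1r addr0.
exact: I01_0.
Qed.

Lemma unit_interval_cell N (s : R) : (0 < N)%N -> I01 s ->
  exists k (t : R), [/\ (k < N)%N, I01 t & N%:R * s = k%:R + t].
Proof.
move=> N0 /andP [s0 s1]; have Ns0 : 0 <= N%:R * s by rewrite mulr_ge0.
have NsN : N%:R * s <= N%:R by rewrite ler_piMr.
have /andP [k1 k2] := truncn_itv Ns0; set k := Num.truncn _ in k1 k2.
have [kN|Nk] := ltnP k N.
  exists k, (N%:R * s - k%:R); split=> //; last by rewrite subrKC.
  by rewrite /I01 /= subr_ge0 k1 /= lerBlDr addrC natr1 ltW.
(* At [s = 1] the truncation is [N], past the last cell, so the right end of that cell is taken. *)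
exists N.-1, 1; split; rewrite ?prednK //; first exact: I01_1.
rewrite natr1 prednK //; apply: le_anti; rewrite NsN /= (le_trans _ k1) //.
by rewrite ler_nat.
Qed.

End Realization.

(** * Concatenation, and free against based null homotopies *)

Section Homotopy.
Variable n : nat.
Local Notation V := 'rV[R]_n.
Implicit Types (A : set V) (g h : R -> V).

(** The base point may move, as it does when a loop is pushed onto a walk; [freely_null_based]
    repairs this. *)
Definition freely_null A g : Prop :=
  exists H : R * R -> V, [/\ continuous H,
    forall s t, I01 s -> I01 t -> A (H (s, t)),
    forall s, I01 s -> H (s, 0) = g s,
    forall s, I01 s -> H (s, 1) = H (0, 1) &
    forall t, I01 t -> H (0, t) = H (1, t)].

(* Paths are concatenated without case distinction, so that continuity is
   immediate: outside of its half, each summand is constant and cancels [P 1]. *)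
Lemma concat_first (P Q : R -> V) (u : R) : P 1 = Q 0 -> u <= 2^-1 ->
  P (clamp (2 * u)) + Q (clamp (2 * u - 1)) - P 1 = P (clamp (2 * u)).
Proof.
by move=> PQ u2; rewrite (@clamp_le0 (2 * u - 1)) ?PQ ?addrK //; lra.
Qed.

Lemma concat_second (P Q : R -> V) (u : R) : P 1 = Q 0 -> 2^-1 <= u ->
  P (clamp (2 * u)) + Q (clamp (2 * u - 1)) - P 1 = Q (clamp (2 * u - 1)).
Proof.
move=> PQ u2; rewrite (@clamp_ge1 (2 * u)); last by lra.
by rewrite addrC addKr.
Qed.

Lemma concat_in A (P Q : R -> V) (u : R) : P 1 = Q 0 ->
  (forall t, I01 t -> A (P t)) -> (forall t, I01 t -> A (Q t)) ->
  A (P (clamp (2 * u)) + Q (clamp (2 * u - 1)) - P 1).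
Proof.
move=> PQ AP AQ; have [u2|/ltW u2] := leP u 2^-1.
  by rewrite concat_first //; apply: AP; exact: clamp_I01.
by rewrite concat_second //; apply: AQ; exact: clamp_I01.
Qed.

Lemma concat0 (P Q : R -> V) : P 1 = Q 0 ->
  P (clamp (2 * 0)) + Q (clamp (2 * 0 - 1)) - P 1 = P 0.
Proof.
by move=> PQ; rewrite concat_first ?invr_ge0 // mulr0 clamp_id //; exact: I01_0.
Qed.

Lemma concat1 (P Q : R -> V) : P 1 = Q 0 ->
  P (clamp (2 * 1)) + Q (clamp (2 * 1 - 1)) - P 1 = Q 1.
Proof.
move=> PQ; rewrite concat_second //; last by lra.
by rewrite clamp_ge1 //; lra.
Qed.

Lemma freely_null_step A (L : R * R -> V) g h : continuous L -> continuous h ->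
  (forall s t, I01 s -> I01 t -> A (L (s, t))) ->
  (forall s, I01 s -> L (s, 0) = g s) -> (forall s, I01 s -> L (s, 1) = h s) ->
  (forall t, I01 t -> L (0, t) = L (1, t)) -> freely_null A h -> freely_null A g.
Proof.
move=> cL ch AL Lg Lh L01 [H [cH AH Hh Hc H01]].
pose G p := L (p.1, clamp (2 * p.2)) + H (p.1, clamp (2 * p.2 - 1)) - h p.1.
have GE s t : I01 s -> G (s, t) =
    L (s, clamp (2 * t)) + H (s, clamp (2 * t - 1)) - L (s, 1).
  by move=> sI; rewrite /G Lh.
have LH s : I01 s -> L (s, 1) = H (s, 0) by move=> sI; rewrite Lh ?Hh.
exists G; split.
- by rewrite /G; cts.
- move=> s t sI tI; rewrite GE //.
  by apply: (@concat_in A (fun t => L (s, t)) (fun t => H (s, t))); auto.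
- move=> s sI; rewrite GE // (@concat0 (fun t => L (s, t)) (fun t => H (s, t))); auto.
- move=> s sI; rewrite GE // (@concat1 (fun t => L (s, t)) (fun t => H (s, t))); auto.
  rewrite GE; last exact: I01_0.
  rewrite (@concat1 (fun t => L (0, t)) (fun t => H (0, t))); auto.
  by apply: LH; exact: I01_0.
- move=> t tI; rewrite !GE; [|exact: I01_1|exact: I01_0].
  rewrite L01; last exact: clamp_I01.
  rewrite H01; last exact: clamp_I01.
  by rewrite L01 //; exact: I01_1.
Qed.

(* The base point of a free null homotopy [H] runs through [t |-> H (0, t)]; the
   homotopy [K1] follows this track, then a stage of [H], then the track back,
   and ends with the track followed by its reverse, which [K2] contracts. *)
Lemma freely_null_based A g : freely_null A g ->
  exists K : R * R -> V, [/\ continuous K,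
    forall s t, I01 s -> I01 t -> A (K (s, t)),
    forall s, I01 s -> K (s, 0) = g s /\ K (s, 1) = g 0 &
    forall t, I01 t -> K (0, t) = g 0 /\ K (1, t) = g 0].
Proof.
case=> H [cH AH Hg Hc H01].
pose m (s : R) : R := 4 * Num.min s (1 - s).
(* [S] stretches the parameter about the midpoint, by the factor 2 at [t = 1]. The tent [m] has
   height 2, and wherever [m s <= t] the value of [S] is 0 or 1: there [K1] runs on the track. At
   [t = 1] the middle half, where [m s >= 1], sits at the constant stage. *)
pose S (s t : R) : R := clamp (2^-1 + (1 + t) * (s - 2^-1)).
pose K1 (s t : R) := H (S s t, clamp (Num.min (m s) t)).
pose K2 (s t : R) := H (0, (1 - t) * clamp (m s)).
have S01 (s t : R) : I01 s -> I01 t -> m s <= t -> S s t = 0 \/ S s t = 1.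
  move=> /andP [s0 s1] /andP [t0 t1]; rewrite /m /S minr_pMr // ge_min => /orP [H1|H1].
    by left; apply: clamp_le0; nra.
  by right; apply: clamp_ge1; nra.
have H01' (s t u : R) : I01 s -> I01 t -> m s <= t -> I01 u -> H (S s t, u) = H (0, u).
  by move=> sI tI mt uI; case: (S01 s t sI tI mt) => ->; rewrite ?H01.
have m_ge0 s : I01 s -> 0 <= m s.
  by move=> /andP [s0 s1]; rewrite /m mulr_ge0 // le_min s0 subr_ge0.
have m0 : m 0 = 0 by rewrite /m subr0 min_l ?mulr0.
have m1 : m 1 = 0 by rewrite /m subrr min_r ?mulr0.
have K12 s : I01 s -> K1 s 1 = K2 s 0.
  move=> sI; rewrite /K1 /K2 subr0 mul1r.
  have [m_le1|/ltW m_ge1] := leP (m s) 1.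
    by rewrite H01' //; [exact: I01_1|exact: clamp_I01].
  rewrite clamp_id; last exact: I01_1.
  by rewrite Hc ?clamp_ge1 //; exact: clamp_I01.
have K10 s : I01 s -> K1 s 0 = g s.
  move=> sI; rewrite /K1 (min_idPr (m_ge0 s sI)) clamp_id; last exact: I01_0.
  by rewrite /S addr0 mul1r addrC subrK clamp_id // Hg.
have K21 s : K2 s 1 = g 0.
  by rewrite /K2 subrr mul0r Hg //; exact: I01_0.
have K1e s t : I01 s -> I01 t -> m s = 0 -> K1 s t = g 0.
  move=> sI tI ms; have /andP [t0 _] := tI.
  rewrite /K1 ms (min_idPl t0) clamp_id; last exact: I01_0.
  rewrite H01' ?ms //; last exact: I01_0.
  by rewrite Hg //; exact: I01_0.
have K2e s t : m s = 0 -> K2 s t = g 0.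
  move=> ms; rewrite /K2 ms clamp_id; last exact: I01_0.
  by rewrite mulr0 Hg //; exact: I01_0.
have AK1 s t : A (K1 s t) by apply: AH; exact: clamp_I01.
have AK2 s t : I01 t -> A (K2 s t).
  move=> /andP [t0 t1]; apply: AH; first exact: I01_0.
  have /andP [c0 c1] := clamp_I01 (m s).
  by apply/andP; split; nra.
exists (fun p => K1 p.1 (clamp (2 * p.2)) + K2 p.1 (clamp (2 * p.2 - 1)) - K1 p.1 1); split.
- by rewrite /K1 /K2 /S /m; cts.
- move=> s t sI tI /=; apply: (@concat_in A (K1 s) (K2 s)); auto.
- move=> s sI /=; rewrite (@concat0 (K1 s) (K2 s)); auto.
  by rewrite (@concat1 (K1 s) (K2 s)); auto.
- have I0 := I01_0; have I1 := I01_1.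
  move=> t tI /=; rewrite !(K2e 0) // !(K2e 1) // !K1e ?addrK //; exact: clamp_I01.
Qed.

Definition joined A (p q : V) : Prop :=
  exists g, [/\ continuous g, forall s, I01 s -> A (g s), g 0 = p & g 1 = q].

Lemma joined_trans A p q r : joined A p q -> joined A q r -> joined A p r.
Proof.
case=> g [cg Ag g0 g1] [h [ch Ah h0 h1]].
have gh : g 1 = h 0 by rewrite g1 h0.
exists (fun s => g (clamp (2 * s)) + h (clamp (2 * s - 1)) - g 1); split.
- by cts.
- by move=> s _; exact: (@concat_in A g h).
- by rewrite concat0.
- by rewrite concat1.
Qed.

End Homotopy.

(** * Loops in the realization and closed walks *)

Section NullHomotopy.
Variable n : nat.
Implicit Types (X : {set {set 'I_n}}) (a : {set 'I_n}) (w : nat -> 'I_n).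

Lemma linear_homotopy_cts (g h : R -> 'rV[R]_n) : continuous g -> continuous h ->
  continuous (fun p : R * R => (1 - p.2) *: g p.1 + p.2 *: h p.1).
Proof. by move=> cg ch; cts. Qed.

Lemma walk_path0 N w : (0 < N)%N -> walk_path N w 0 = vertex (w 0%N).
Proof. by move=> N0; apply: walk_path_vertex => //; rewrite mulr0. Qed.

Lemma walk_path1 N w : (0 < N)%N -> walk_path N w 1 = vertex (w N).
Proof. by move=> N0; apply: walk_path_vertex => //; rewrite mulr1. Qed.

Lemma walk_path_in X N w (s : R) : is_complex X -> (0 < N)%N ->
  (forall k, (k < N)%N -> [set w k; w k.+1]%SET \in X) -> I01 s ->
  realization X (walk_path N w s).
Proof.
move=> cX N0 wX sI; have [k [t [kN tI E]]] := unit_interval_cell N0 sI.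
rewrite (walk_path_eval _ kN tI E); apply: (in_simplex_realization cX (wX k kN)).
by apply: in_simplex_segment => //; apply: in_simplex_vertex; rewrite !inE eqxx ?orbT.
Qed.

Lemma contractible_walk_freely_null X N w : is_complex X -> (0 < N)%N ->
  contractible_walk X N w -> w 0%N = w N -> freely_null (realization X) (walk_path N w).
Proof.
move=> cX N0; elim=> {w} [w x xX wx _|w w' ww' w'N _ IH wN].
  exists (fun p => walk_path N w p.1).
  have E s : I01 s -> walk_path N w s = vertex x.
    move=> sI; have [k [t [kN tI E]]] := unit_interval_cell N0 sI.
    rewrite (walk_path_eval _ kN tI E) !wx //; last exact: ltnW.
    by rewrite -scalerDl subrK scale1r.
  split=> /=.
  - by apply: cts_comp cts_fst; exact: walk_path_cts.
  - move=> s t sI tI; rewrite E //; apply: (in_simplex_realization cX xX).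
    by apply: in_simplex_vertex; rewrite inE.
  - by [].
  - by move=> s sI; rewrite !E //; exact: I01_0.
  - by move=> _ _; rewrite !E //; [exact: I01_1|exact: I01_0].
apply: (freely_null_step (L := fun p => (1 - p.2) *: walk_path N w p.1 +
  p.2 *: walk_path N w' p.1)) (IH w'N).
- by apply: linear_homotopy_cts; exact: walk_path_cts.
- exact: walk_path_cts.
- move=> s t sI tI /=; have [k [u [kN uI E]]] := unit_interval_cell N0 sI.
  rewrite !(walk_path_eval _ kN uI E); apply: (in_simplex_realization cX (ww' k kN)).
  by do 2?[apply: in_simplex_segment => //]; apply: in_simplex_vertex; rewrite !inE eqxx ?orbT.
- by move=> s _ /=; rewrite subr0 scale1r scale0r addr0.
- by move=> s _ /=; rewrite subrr scale1r scale0r add0r.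
- by move=> t _ /=; rewrite !walk_path0 // !walk_path1 // wN w'N.
Qed.

Lemma joined_segment X a p q : is_complex X -> a \in X -> in_simplex a p -> in_simplex a q ->
  joined (realization X) p q.
Proof.
move=> cX aX pa qa; exists (fun s => (1 - s) *: p + s *: q); split.
- by cts.
- by move=> s sI; apply: (in_simplex_realization cX aX); exact: in_simplex_segment.
- by rewrite subr0 scale1r scale0r addr0.
- by rewrite subrr scale1r scale0r add0r.
Qed.

Lemma realization_joined X p q : is_complex X -> complex_connected X ->
  realization X p -> realization X q -> joined (realization X) p q.
Proof.
move=> cX con Xp Xq.
have near_vertex r : realization X r -> exists v, [/\ [set v]%SET \in X,
    joined (realization X) r (vertex v) & joined (realization X) (vertex v) r].
  move=> Xr; have [a [aX ra supp]] := realization_in_simplex Xr.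
  have [v va] : exists v, v \in a.
    apply: contrapT => /forallNP a0; have [_ r1 r2] := ra.
    have : (1 : R) = 0 by rewrite -r1 big1 // => i _; apply: r2; exact/negP.
    by move/eqP; rewrite oner_eq0.
  exists v; split; first by apply: cX aX _; rewrite finset.sub1set.
    by apply: (joined_segment cX aX) => //; exact: in_simplex_vertex.
  by apply: (joined_segment cX aX) => //; exact: in_simplex_vertex.
have [u [uX pu _]] := near_vertex p Xp; have [v [vX _ vq]] := near_vertex q Xq.
apply: joined_trans pu _; apply: joined_trans vq.
have /connectP [s] := con u v uX vX.
elim: s u uX => [|x s IH] u uX /=.
  move=> _ ->; apply: (joined_segment cX uX); by apply: in_simplex_vertex; rewrite inE.
move=> /andP [uxX sp] vE; have xX : [set x]%SET \in X.
  by apply: cX uxX _; rewrite finset.sub1set !inE eqxx orbT.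
apply: joined_trans (IH x xX sp vE); apply: (joined_segment cX uxX).
  by apply: in_simplex_vertex; rewrite !inE eqxx.
by apply: in_simplex_vertex; rewrite !inE eqxx orbT.
Qed.

Lemma ball_I01_step N k (s t : R) (d : R) : (0 < N)%N -> N%:R^-1 < d -> I01 t ->
  N%:R * s = k%:R + t -> ball (k%:R / N%:R : R) d s /\ ball (k.+1%:R / N%:R : R) d s.
Proof.
move=> N0 Nd /andP [t0 t1] E; have Np : 0 < N%:R :> R by rewrite ltr0n.
have Es : s = (k%:R + t) / N%:R by rewrite -E mulrAC mulfV ?mul1r // gt_eqF.
have Ni : 0 < (N%:R : R)^-1 by rewrite invr_gt0.
rewrite /ball /= Es -!mulrBl !normrM (gtr0_norm Ni).
have H (x : R) : `|x| <= 1 -> `|x| * N%:R^-1 < d.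
  by move=> x1; apply: le_lt_trans Nd; rewrite ler_piMl // ltW.
split; apply: H.
  by rewrite opprD addrA subrr add0r normrN ger0_norm.
rewrite -natr1; have -> : k%:R + 1 - (k%:R + t) = 1 - t by lra.
by rewrite ger0_norm ?subr_ge0 //; lra.
Qed.

(** On a fine subdivision the label of each knot stays in the support of the loop throughout the
    adjacent cells. The labels form a closed walk whose path shares a simplex with the loop at every
    time, so the straight-line homotopy stays in the realization. *)
Lemma contractible_simply_connected X : is_complex X -> complex_connected X ->
  (exists v, [set v]%SET \in X) ->
  (forall N w, (0 < N)%N -> (forall k, (k < N)%N -> [set w k; w k.+1]%SET \in X) ->
     w 0%N = w N -> contractible_walk X N w) ->
  simply_connected (realization X).
Proof.
move=> cX con [v vX] HX.
have Xv : realization X (vertex v).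
  by apply: (in_simplex_realization cX vX); apply: in_simplex_vertex; rewrite inE.
split; first by exists (vertex v).
split=> [x y Xx Xy|g [cg Xg] g01].
  have [g [cg Xg g0 g1]] := realization_joined cX con Xx Xy.
  by exists g; split=> //; split=> //; exact: continuous_subspaceT.
pose f (s : R) := g (clamp s).
have cf : continuous f.
  by apply: within_comp cg _ clamp_I01; apply: cts_clamp; exact: cts_id.
have Xf s : realization X (f s) by apply: Xg; exact: clamp_I01.
have fE s : I01 s -> f s = g s by move=> sI; rewrite /f clamp_id.
have f01 : f 0 = f 1 by rewrite !fE //; [exact: I01_1|exact: I01_0].
have [lab Hlab] := exists_label (ex_intro _ _ Xv).
have n0 : (0 < n)%N by exact: leq_ltn_trans (ltn_ord v).
have ninv : 0 < (n%:R : R)^-1 by rewrite invr_gt0 ltr0n.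
have [d d0 Hd] := heine_cantor I01_compact cf ninv.
have [N N0 HN] := exists_inv_lt d0.
have Np : 0 < N%:R :> R by rewrite ltr0n.
have knot k : (k <= N)%N -> I01 (k%:R / N%:R).
  move=> kN; rewrite /I01 /= divr_ge0 ?ler0n //=.
  by rewrite ler_pdivrMr // mul1r ler_nat.
pose w k := lab (f (k%:R / N%:R)).
have close k s : (k <= N)%N -> ball (k%:R / N%:R : R) d s -> f s ord0 (w k) != 0.
  move=> kN ks; have := Hd _ _ (knot k kN) ks (w k).
  have := Hlab (f (k%:R / N%:R)) (Xf _); rewrite -/(w k) => H1 /ltr_normlW H2.
  by rewrite gt_eqF //; lra.
have w0N : w 0%N = w N by rewrite /w mul0r divff ?gt_eqF // f01.
have wX k : (k < N)%N -> [set w k; w k.+1]%SET \in X.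
  move=> kN; have [a [aX _ supp]] := realization_in_simplex (Xf (k%:R / N%:R)).
  have [|B1 B2] := @ball_I01_step N k (k%:R / N%:R) 0 d N0 (HN N (leqnn N)) I01_0.
    by rewrite addr0 mulrCA mulfV ?mulr1 // gt_eqF.
  apply: cX aX _; rewrite finset.subUset !finset.sub1set.
  apply/andP; split; apply: supp; apply: close => //.
  exact: ltnW.
have null : freely_null (realization X) f.
  apply: (freely_null_step (h := walk_path N w)
    (L := fun p => (1 - p.2) *: f p.1 + p.2 *: walk_path N w p.1)).
  - by apply: linear_homotopy_cts => //; exact: walk_path_cts.
  - exact: walk_path_cts.
  - move=> s t sI tI /=; have [k [u [kN uI E]]] := unit_interval_cell N0 sI.
    rewrite (walk_path_eval _ kN uI E).
    have [a [aX fa supp]] := realization_in_simplex (Xf s).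
    have [B1 B2] := ball_I01_step N0 (HN N (leqnn N)) uI E.
    apply: (in_simplex_realization cX aX); apply: in_simplex_segment => //.
    by apply: in_simplex_segment => //; apply: in_simplex_vertex; apply: supp;
      apply: close => //; exact: ltnW.
  - by move=> s _ /=; rewrite subr0 scale1r scale0r addr0.
  - by move=> s _ /=; rewrite subrr scale1r scale0r add0r.
  - by move=> t _ /=; rewrite !walk_path0 // !walk_path1 // w0N f01.
  - by apply: contractible_walk_freely_null => //; exact: HX.
have [K [cK XK K01 Kb]] := freely_null_based null.
exists K; split; first exact: continuous_subspaceT.
have f0 : f 0 = g 0 by rewrite fE //; exact: I01_0.
split=> //; split=> [s sI|t tI].
  by have [-> ->] := K01 s sI; rewrite fE // f0.
by have [-> ->] := Kb t tI; rewrite f0.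
Qed.

End NullHomotopy.

(** * Acyclicity of simply connected realizations *)

Section WalkSums.
Variables (T : finType) (X : {set {set T}}) (c : T -> T -> bool).
Hypotheses (cX : is_complex X) (cc : Z2_cocycle X c).
Implicit Types (w u : nat -> T) (b : {set T}).

Definition walk_sum (N : nat) w : bool := \big[addb/false]_(i < N) c (w i) (w i.+1).

Lemma cocycle_on_face b x y z : b \in X -> x \in b -> y \in b -> z \in b ->
  c x y (+) c y z = c x z.
Proof.
move=> bX xb yb zb; apply: cc; apply: cX bX _.
by rewrite !finset.subUset !finset.sub1set xb yb zb.
Qed.

Lemma cocycle_refl x : [set x]%SET \in X -> c x x = false.
Proof.
move=> xX; have xx : x \in [set x]%SET by rewrite inE.
by have := cocycle_on_face xX xx xx xx; case: (c x x).
Qed.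

(** Each square of the strip lies in a face, so both ways around it have equal sums; the rungs
    telescope and leave the two end terms. *)
Lemma walk_sum_strip N w u :
  (forall i, (i < N)%N -> exists b,
     [/\ b \in X, w i \in b, w i.+1 \in b, u i \in b & u i.+1 \in b]) ->
  walk_sum N w (+) c (w N) (u N) = c (w 0%N) (u 0%N) (+) walk_sum N u.
Proof.
rewrite /walk_sum; elim: N => [|N IH] H; first by rewrite !big_ord0 addbF.
rewrite !big_ord_recr /=; have [b [bX wb w'b ub u'b]] := H N (ltnSn N).
rewrite addbA -IH => [|i iN]; last by apply: H; exact: ltnW.
rewrite -!addbA (cocycle_on_face bX wb w'b u'b).
by rewrite (cocycle_on_face bX wb ub u'b).
Qed.

Lemma walk_sum_subdivision M K w u : (0 < M)%N -> (0 < K)%N ->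
  (forall k, (k < M)%N -> [set w k; w k.+1]%SET \in X) ->
  (forall k r, (k < M)%N -> (r <= K)%N -> u (k * K + r)%N \in [set w k; w k.+1]%SET) ->
  (forall k, (k <= M)%N -> u (k * K)%N = w k) ->
  walk_sum (M * K) u = walk_sum M w.
Proof.
move=> M0 K0 wX uw uK.
have vX k : (k <= M)%N -> [set w k]%SET \in X.
  case: k => [_|k kM]; first by apply: cX (wX 0%N M0) _; rewrite finset.sub1set !inE eqxx.
  by apply: cX (wX k kM) _; rewrite finset.sub1set !inE eqxx orbT.
have step k r : (k < M)%N -> (r <= K)%N -> walk_sum (k * K) u = walk_sum k w ->
    walk_sum (k * K + r) u = walk_sum k w (+) c (w k) (u (k * K + r)%N).
  move=> kM + E; elim: r => [_|r IH rK].
    by rewrite addn0 uK ?cocycle_refl ?vX ?addbF //; exact: ltnW.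
  rewrite addnS /walk_sum big_ord_recr /= -/(walk_sum _ _) IH; last exact: ltnW.
  have wk : w k \in [set w k; w k.+1]%SET by rewrite !inE eqxx.
  have ur := uw k r kM (ltnW rK); have ur1 := uw k r.+1 kM rK; rewrite addnS in ur1.
  by rewrite -addbA (cocycle_on_face (wX k kM) wk ur ur1).
have all k : (k <= M)%N -> walk_sum (k * K) u = walk_sum k w.
  elim: k => [_|k IH kM]; first by rewrite mul0n /walk_sum !big_ord0.
  have := step k K kM (leqnn K) (IH (ltnW kM)).
  by rewrite addnC -mulSn => ->; rewrite uK // [in RHS]/walk_sum big_ord_recr.
exact: all.
Qed.

(** Walks recorded by their ends and sum only, which makes concatenation free of index
    arithmetic. *)
Inductive reach : T -> T -> bool -> Prop :=
| reach_refl x : reach x x false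
| reach_edge x y z e : [set x; y]%SET \in X -> reach y z e -> reach x z (c x y (+) e).

Lemma reach_trans x y z e e' : reach x y e -> reach y z e' -> reach x z (e (+) e').
Proof.
move=> xy; elim: xy => {x y e} [x //|x y t e xyX _ IH] /IH yz.
by rewrite -addbA; exact: reach_edge.
Qed.

Lemma reach_walk x y e : reach x y e -> exists N w, [/\ w 0%N = x, w N = y,
  forall k, (k < N)%N -> [set w k; w k.+1]%SET \in X & walk_sum N w = e].
Proof.
elim=> {x y e} [x|x y z e xyX _ [N [w [w0 wN wX ws]]]].
  by exists 0%N, (fun=> x); split=> //; rewrite /walk_sum big_ord0.
exists N.+1, (fun k => if k is k'.+1 then w k' else x); split=> //.
  by case=> [|k] /= kN; [rewrite w0|exact: wX].
by rewrite /walk_sum big_ord_recl /= w0 -ws.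
Qed.

Lemma acyclic_of_closed_walks : complex_connected X -> (exists v, [set v]%SET \in X) ->
  (forall N w, (0 < N)%N -> (forall k, (k < N)%N -> [set w k; w k.+1]%SET \in X) ->
     w 0%N = w N -> walk_sum N w = false) ->
  exists f : T -> bool, forall x y, [set x; y]%SET \in X -> c x y = f x (+) f y.
Proof.
move=> con [v vX] H.
have loop x e : reach x x e -> e = false.
  move=> /reach_walk [[|N] [w [w0 wN wX <-]]]; first by rewrite /walk_sum big_ord0.
  by apply: H => //; rewrite w0 wN.
have reachable x y : [set x]%SET \in X -> [set y]%SET \in X -> exists e, reach x y e.
  move=> xX yX; have /connectP [p] := con x y xX yX.
  elim: p x {xX} => [|z p IH] x /=; first by move=> _ ->; exists false; exact: reach_refl.
  move=> /andP [xz pz] yE; have [e ze] := IH z pz yE.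
  by exists (c x z (+) e); exact: reach_edge.
have /choice [f Hf] : forall x, exists e, [set x]%SET \in X -> reach v x e.
  move=> x; have [xX|_] := boolP ([set x]%SET \in X); last by exists false.
  by have [e He] := reachable v x vX xX; exists e.
exists f => x y xyX.
have xX : [set x]%SET \in X by apply: cX xyX _; rewrite finset.sub1set !inE eqxx.
have yX : [set y]%SET \in X by apply: cX xyX _; rewrite finset.sub1set !inE eqxx orbT.
(* Two closed walks at [v] share the return from [y]: one goes straight to [y], the other to [x] and
   along the edge to [y]. Both sums vanish, and comparing them expresses [c x y]. *)
have [e ye] := reachable y v yX vX.
have := loop _ _ (reach_trans (Hf y yX) ye).
have := loop _ _ (reach_trans (Hf x xX) (reach_edge xyX ye)).
by case: (f x); case: (f y); case: (c x y); case: e {ye}.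
Qed.

End WalkSums.

(** * Sampling a null homotopy on a grid *)

Section Acyclic.
Variable n : nat.
Implicit Types (X : {set {set 'I_n}}) (w : nat -> 'I_n).

(* A filling of the loop [walk_path M w] is sampled on a fine square grid; the
   labels on the corners of each small square lie in a common face. *)
Lemma closed_walk_sum X c M w : is_complex X -> simply_connected (realization X) ->
  Z2_cocycle X c -> (0 < M)%N -> (forall k, (k < M)%N -> [set w k; w k.+1]%SET \in X) ->
  w 0%N = w M -> walk_sum c M w = false.
Proof.
move=> cX [[p0 Xp0] [_ null]] cc M0 wX w0M.
have I0 := I01_0; have I1 := I01_1.
pose g := walk_path M w.
have g0 : g 0 = vertex (w 0%N) by exact: walk_path0.
have g01 : g 0 = g 1 by rewrite g0 /g walk_path1 // w0M.
have [|H [cH [XH [Hs Ht]]]] := null g _ g01.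
  split; first by apply: continuous_subspaceT; exact: walk_path_cts.
  by move=> s sI; exact: walk_path_in.
pose h (p : R * R) := H (clamp p.1, clamp p.2).
have ch : continuous h.
  apply: (within_comp cH (g := fun p : R * R => (clamp p.1, clamp p.2))); first by cts.
  by move=> p; split; exact: clamp_I01.
have hE s t : I01 s -> I01 t -> h (s, t) = H (s, t) by move=> sI tI; rewrite /h /= !clamp_id.
have Xh p : realization X (h p) by apply: XH; exact: clamp_I01.
have [lab Hlab] := exists_label (ex_intro _ _ Xp0).
have n0 : (0 < n)%N by exact: leq_ltn_trans (ltn_ord (w 0%N)).
have ninv : 0 < (n%:R : R)^-1 by rewrite invr_gt0 ltr0n.
have labN0 p : realization X p -> p ord0 (lab p) != 0.
  by move=> /Hlab Xp; rewrite gt_eqF // (lt_le_trans ninv).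
have [d d0 Hd] := heine_cantor (compact_setX I01_compact I01_compact) ch ninv.
have [K K0 HK] := exists_inv_lt d0.
(* A multiple of [M] keeps the vertices of the walk among the knots of the bottom row, and [K <= N]
   keeps the mesh fine. *)
pose N := (M * K)%N.
have KN : (K <= N)%N by rewrite leq_pmull.
have N0 : (0 < N)%N by exact: leq_trans KN.
have Np : 0 < N%:R :> R by rewrite ltr0n.
have Nd := HK N KN.
have knot k : (k <= N)%N -> I01 (k%:R / N%:R).
  move=> kN; rewrite /I01 /= divr_ge0 ?ler0n //=.
  by rewrite ler_pdivrMr // mul1r ler_nat.
pose a i j := lab (h (i%:R / N%:R, j%:R / N%:R)).
have step k : ball (k%:R / N%:R : R) d (k%:R / N%:R : R) /\
    ball (k.+1%:R / N%:R : R) d (k%:R / N%:R : R).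
  apply: ball_I01_step N0 Nd I01_0 _.
  by rewrite addr0 mulrCA mulfV ?mulr1 // gt_eqF.
have close i j s t : (i <= N)%N -> (j <= N)%N -> ball (i%:R / N%:R : R) d s ->
    ball (j%:R / N%:R : R) d t -> h (s, t) ord0 (a i j) != 0.
  move=> iN jN B1 B2.
  have := Hd (i%:R / N%:R, j%:R / N%:R) (s, t) (conj (knot i iN) (knot j jN)) (conj B1 B2) (a i j).
  have := Hlab _ (Xh (i%:R / N%:R, j%:R / N%:R)); rewrite -/(a i j) => H1 /ltr_normlW H2.
  by rewrite gt_eqF //; lra.
have zeroN : 0 / N%:R = 0 :> R by rewrite mul0r.
have oneN : N%:R / N%:R = 1 :> R by rewrite divff // gt_eqF.
have a0 j : (j <= N)%N -> a 0%N j = lab (g 0).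
  by move=> jN; rewrite /a zeroN hE ?(Ht _ (knot j jN)).1 //; exact: knot.
have aN j : (j <= N)%N -> a N j = lab (g 0).
  by move=> jN; rewrite /a oneN hE ?(Ht _ (knot j jN)).2 //; exact: knot.
have labg : lab (g 0) = w 0%N.
  have Xg : realization X (g 0) by apply: walk_path_in.
  apply: contraTeq (labN0 _ Xg) => /negbTE E; by rewrite {1}g0 vertexE E eqxx.
have w00 : c (w 0%N) (w 0%N) = false.
  apply: (cocycle_refl cX cc); apply: cX (wX 0%N M0) _.
  by rewrite finset.sub1set !inE eqxx.
(* Every row of labels starts and ends at [w 0], since the homotopy fixes the base point; so the end
   terms of [walk_sum_strip] vanish and neighbouring rows have equal sums. *)
pose S j := walk_sum c N (a^~ j).
have SS j : (j < N)%N -> S j = S j.+1.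
  move=> jN; have := @walk_sum_strip _ X c cX cc N (a^~ j) (a^~ j.+1).
  rewrite !a0 ?aN ?labg ?w00 ?addbF ?addFb //; try exact: ltnW; apply => i iN.
  have [b [bX _ supp]] := realization_in_simplex (Xh (i%:R / N%:R, j%:R / N%:R)).
  have [Bi Bi1] := step i; have [Bj Bj1] := step j.
  by exists b; split=> //; apply: supp; apply: close => //; exact: ltnW.
have S0 j : (j <= N)%N -> S 0%N = S j.
  by elim: j => [//|j IH jN]; rewrite (IH (ltnW jN)) (SS j jN).
(* Points of the bottom row lie on edges of the walk, so their labels are endpoints of these edges
   and the row subdivides the walk. *)
have <- : S 0%N = walk_sum c M w.
  have ai0 i : (i <= N)%N -> a i 0%N = lab (g (i%:R / N%:R)).
    by move=> iN; rewrite /a zeroN hE ?(Hs _ (knot i iN)).1 //; exact: knot.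
  have MN i : M%:R * (i%:R / N%:R) = i%:R / K%:R :> R.
    by rewrite /N natrM invfM mulrCA (mulrA M%:R) divff ?mul1r // pnatr_eq0 -lt0n.
  have Kp : K%:R != 0 :> R by rewrite pnatr_eq0 -lt0n.
  apply: (walk_sum_subdivision cX cc) => // [k r kM rK|k kM].
    have iN : (k * K + r <= N)%N.
      by apply: leq_trans (leq_add (leqnn _) rK) _; rewrite addnC -mulSn leq_mul2r kM orbT.
    rewrite ai0 //; have Xg : realization X (g ((k * K + r)%:R / N%:R)).
      by apply: walk_path_in => //; exact: knot.
    have tI : I01 (r%:R / K%:R).
      rewrite /I01 /= divr_ge0 ?ler0n //=.
      by rewrite ler_pdivrMr ?ltr0n // mul1r ler_nat.
    have E : g ((k * K + r)%:R / N%:R) =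
        (1 - r%:R / K%:R) *: vertex (w k) + r%:R / K%:R *: vertex (w k.+1).
      by apply: walk_path_eval => //; rewrite MN natrD natrM mulrDl mulfK.
    have [_ _ supp] : in_simplex [set w k; w k.+1]%SET (g ((k * K + r)%:R / N%:R)).
      by rewrite E; apply: in_simplex_segment => //; apply: in_simplex_vertex;
        rewrite !inE eqxx ?orbT.
    by apply: contraR (labN0 _ Xg) => /supp ->.
  have iN : (k * K <= N)%N by rewrite leq_mul2r kM orbT.
  rewrite ai0 //; have Xg : realization X (g ((k * K)%:R / N%:R)).
    by apply: walk_path_in => //; exact: knot.
  apply: contraTeq (labN0 _ Xg) => /negbTE E; rewrite {1}/g (walk_path_vertex _ M0 kM).
    by rewrite vertexE E eqxx.
  by rewrite MN natrM mulfK.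
(* The top row samples the constant loop, so all its labels are [w 0]. *)
rewrite (S0 N) // /S /walk_sum big1 // => i _.
have aiN k : (k <= N)%N -> a k N = w 0%N.
  move=> kN; rewrite /a oneN hE ?(Hs _ (knot k kN)).2 //; exact: knot.
by rewrite !aiN ?w00 //; exact: ltnW.
Qed.

Lemma simply_connected_acyclic X : is_complex X -> complex_connected X ->
  simply_connected (realization X) -> Z2_acyclic X.
Proof.
move=> cX con sX c cc; apply: (acyclic_of_closed_walks cX) => //; last first.
  by move=> N w N0 wX w0N; exact: (closed_walk_sum cX sX cc).
have [[p Xp] _] := sX; have [lab Hlab] := exists_label (ex_intro _ _ Xp).
have [a [aX _ supp]] := realization_in_simplex Xp.
exists (lab p); apply: cX aX _; rewrite finset.sub1set; apply: supp.
rewrite gt_eqF // (lt_le_trans _ (Hlab p Xp)) // invr_gt0 ltr0n.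
exact: leq_ltn_trans (ltn_ord (lab p)).
Qed.

End Acyclic.

End Topology.

Theorem theorem4p15 (n d : nat) (X : {set {set 'I_n}}) :
  4 <= d -> normal_pseudomanifold d X ->
  (stacked_sphere d X <-> (in_K d X /\ simply_connected (realization X))).
Proof.
move=> d4 nX; have [_ [[cX [[a [aX ca]] _]] _]] := nX.
have conX := normal_pseudomanifold_connected nX.
split=> [stX|[KX sX]]; last first.
  apply: in_K_acyclic_stacked KX _ => //; exact: simply_connected_acyclic.
split; first by apply: stacked_sphere_in_K => //; exact: leq_trans d4.
apply: contractible_simply_connected => // [|N w N0 wX w0N]; last first.
  exact: stacked_sphere_contractible_walk stX N0 wX w0N.
have [x xa] : exists x, x \in a by apply/finset.set0Pn; rewrite -card_gt0 ca.
by exists x; apply: cX aX _; rewrite finset.sub1set.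
Qed.
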